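(* Let $G$ be a finite graph with distinct cospectral vertices $u,v\in V(G)$, such that $0$ is not an eigenvalue of the adjacency matrix of $G\setminus\{u,v\}$. For an integer $q\ge 0$, construct $G_q$ by gluing a path of length $q$ to $G$ by attaching its endpoints to $u$ and $v$; in other words, by adding $q-1$ new nodes $x_1,\dots,x_{q-1}$ to $G$ together with the edges $ux_1,x_1x_2,\dots,x_{q-2}x_{q-1},x_{q-1}v$ (for $q=0$ take $G_0=G$). Let $Q\in\mathbb{R}$ be a transcendental number, and put a potential $Q$ at the nodes $u$ and $v$ in $G_q$. Then either this potential induces PGST between $u$ and $v$ in $G$, or there is an infinite set $S$ of nonnegative integers such that this potential induces PGST between $u$ and $v$ in $G_q$ for all $q\in S$.
   Context: Vertices $u,v$ of $G$ are cospectral if the adjacency matrices of $G\setminus u$ and $G\setminus v$ have the same characteristic polynomial. For a graph $H$ containing $u,v$ with adjacency matrix $A_H$ (multiple edges are allowed and counted in $A_H$; for $q=1$ the construction adds a single edge $uv$), putting a potential $Q$ at $u$ and $v$ means replacing $A_H$ by $N=A_H+Q\cdot D_{uv}$, where $D_{uv}$ is the diagonal matrix with 1 in positions $u,v$ and 0 elsewhere. The potential induces PGST (pretty good state transfer) between $u$ and $v$ in $H$ if $\limsup_{t\to\infty}|(e^{itN})(u,v)|=1$. *)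

(* Defs.v *)
From HB Require Import structures.
From mathcomp Require Import all_boot all_order all_algebra.
From mathcomp Require Import complex.
From mathcomp Require Import all_classical all_reals all_analysis.

Set Implicit Arguments.
Unset Strict Implicit.
Unset Printing Implicit Defensive.

Import Order.TTheory GRing.Theory Num.Theory.
Import numFieldNormedType.Exports.

Local Open Scope ring_scope.

(* A finite graph on V is given by its edge multiplicities: e x y is the number
   of edges joining x and y.  A simple graph is the case e x y <= 1. *)
Definition is_graph (V : finType) (e : V -> V -> nat) : Prop :=
  (forall x y, e x y = e y x) /\ (forall x, e x x = 0%N).

(* Rows and columns are numbered along enum V. *)
Definition adjmx (R : pzSemiRingType) (V : finType) (e : V -> V -> nat) :
    'M[R]_#|V| :=
  \matrix_(i, j) (e (enum_val i) (enum_val j))%:R.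

Definition del_vertices (V : finType) (e : V -> V -> nat) (A : {set V}) :
    {x : V | x \notin A} -> {x : V | x \notin A} -> nat :=
  fun x y => e (val x) (val y).
Arguments del_vertices [V] e A.

Definition cospectral (R : comNzRingType) (V : finType) (e : V -> V -> nat)
    (u v : V) : Prop :=
  char_poly (adjmx R (del_vertices e [set u])) =
  char_poly (adjmx R (del_vertices e [set v])).

(* The k-th node (0 <= k <= q) of a path of length q from u to v whose q - 1
   inner nodes are new: inl u, inr 0, ..., inr (q - 2), inl v. *)
Definition path_node (V : finType) (u v : V) (q k : nat) : V + 'I_q.-1 :=
  if k is j.+1 then (if insub j is Some i then inr i else inl v) else inl u.

(* For q = 0 no node and no edge is added; for q = 1 the multiplicity of the
   pair u, v increases by one. *)
Definition glue_path (V : finType) (e : V -> V -> nat) (u v : V) (q : nat) :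
    V + 'I_q.-1 -> V + 'I_q.-1 -> nat :=
  fun a b =>
    ((match a, b with inl x, inl y => e x y | _, _ => 0 end) +
     \sum_(k < q)
        (((path_node u v q k == a) && (path_node u v q k.+1 == b))
         || ((path_node u v q k == b) && (path_node u v q k.+1 == a))))%N.

Arguments glue_path [V] e u v q.

Lemma glue_path_is_graph (V : finType) (e : V -> V -> nat) (u v : V) (q : nat) :
  u != v -> is_graph e -> is_graph (glue_path e u v q).
Proof.
move=> uv [eC e0]; split=> [a b|a].
  congr addn; last by apply: eq_bigr => k _; rewrite orbC.
  by case: a b => [x|i] [y|j].
rewrite /glue_path big1 ?addn0; first by case: a.
move=> [[|k] ltkq] _; rewrite orbb /=; case: andP => //= -[/eqP <-].
  case: insubP => //= _ /eqP[] vu.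
  by rewrite vu eqxx in uv.
have ltk : (k < q.-1)%N by rewrite -ltnS (ltn_predK ltkq).
rewrite (@insubT _ _ 'I_q.-1 _ ltk) /=; case: insubP => //= j _ jk /eqP[] ji.
by move: jk; rewrite ji /= => /n_Sn.
Qed.

Definition potential_mx (R : pzSemiRingType) (V : finType) (u v : V) :
    'M[R]_#|V| :=
  diag_mx (\row_i (enum_val i \in [set u; v])%:R).

Definition hamiltonian (R : pzRingType) (V : finType) (e : V -> V -> nat)
    (u v : V) (Q : R) : 'M[R]_#|V| :=
  adjmx R e + Q *: potential_mx R u v.

Definition mxexp (K : numFieldType) (n : nat) (A : 'M[K]_n) : 'M[K]_n :=
  limn (series (fun k : nat => (k`!%:R)^-1 *: A ^+ k)).

Definition transfer_amplitude (R : realType) (V : finType)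
    (e : V -> V -> nat) (u v : V) (Q t : R) : R[i] :=
  mxexp ((0 +i* t)%C *: map_mx (real_complex R) (hamiltonian e u v Q))
    (enum_rank u) (enum_rank v).

Definition induces_PGST (R : realType) (V : finType) (e : V -> V -> nat)
    (u v : V) (Q : R) : Prop :=
  limf_esup (fun t : R =>
    (Normc.normc (transfer_amplitude e u v Q t))%:E) +oo%R = 1%E.

Definition transcendental (R : realType) (x : R) : Prop :=
  ~ algebraicOver (ratr : rat -> R) x.

(* Main.v *)
Require Import Defs.
From HB Require Import structures.
From mathcomp Require Import all_boot all_order all_algebra.
From mathcomp Require Import perm complex ring lra zify.
From mathcomp Require Import all_classical all_reals all_analysis.

(* In the eigenbasis of the Hamiltonian N the amplitude at time t is a sum of
   exponentials exp(i t lambda) with real weights w whose absolute values add up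
   to 1; positive weights come from the component of the eigenvector along
   b_u + b_v, negative ones from the component along b_u - b_v.  By a mean value
   argument of Bohr's, the modulus of such a sum comes back arbitrarily close to 1
   unless some integer relation between the lambda, with coefficients of sum 0,
   has a nonzero sum of coefficients over the negative weights.

   For cospectral u, v the lambda of positive (negative) weight are roots of
   P_s = f_s - Q c_s with s = +1 (s = -1), where f_s, c_s are coprime rational
   polynomials.  As Q is transcendental, P_s is irreducible over rat(Q), and
   taking traces in a relation between the lambda shows that PGST holds as soon
   as the mean of the roots of P_+ differs from that of P_-.  By transcendence
   again, equality of the means forces P_+ and P_- to have the same degree and
   the same sum of roots.  Gluing a path of odd length 2m + 1 raises both degrees
   by m (as soon as the path polynomial is prime to c_+ c_-, which holds along an
   arithmetic progression of lengths), but changes the sum of the roots by +1 for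
   one sign and by -1 for the other; so PGST holds in G or in all these G_q. *)

Set Implicit Arguments.
Unset Strict Implicit.
Unset Printing Implicit Defensive.

Import Order.TTheory GRing.Theory Num.Theory.
Import numFieldNormedType.Exports.

Local Open Scope ring_scope.

(** * Traces and linear relations between conjugates *)

(* The factor 'X makes the value 0, instead of 1, at p = 1. *)
Definition subcoef (R : nzRingType) (p : {poly R}) : R := ('X * p)`_(size p).-1.

Lemma subcoef1 (R : nzRingType) : subcoef (1 : {poly R}) = 0.
Proof. by rewrite /subcoef mulr1 size_poly1 coefX. Qed.

(** For monic p, [subcoef p] is minus the sum of the roots. In the convolution only the two terms
    that pair a leading coefficient with a second one survive. *)
Lemma subcoefM (R : idomainType) (p q : {poly R}) :
  p \is monic -> q \is monic -> subcoef (p * q) = subcoef p + subcoef q.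
Proof.
move=> mp mq.
have p0 := monic_neq0 mp; have q0 := monic_neq0 mq.
have sp : size p = (size p).-1.+1 by rewrite prednK // size_poly_gt0.
have [sq1|sq1] := leqP (size q) 1.
  have q1 : q = 1.
    have := size1_polyC sq1; move: mq => /monicP + qE; rewrite qE lead_coefC.
    by move=> ->.
  by rewrite q1 mulr1 subcoef1 addr0.
set a := (size p).-1; set b := (size q).-2.
have sq : size q = b.+2 by rewrite /b; case: (size q) sq1 => [|[]].
rewrite /subcoef size_mul // sp sq !addSn addnS /= -/a mulrA coefM.
have la : p`_a = 1 by move/monicP: mp.
have lb : q`_b.+1 = 1 by move/monicP: mq; rewrite lead_coefE sq.
have ia_lt : (a < (a + b.+1).+1)%N by lia.
have ib_lt : (a.+1 < (a + b.+1).+1)%N by lia.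
rewrite (bigD1 (Ordinal ia_lt)) //= addKn lb mulr1; congr (_ + _).
rewrite (bigD1 (Ordinal ib_lt)) /=; last by rewrite -val_eqE /= neq_ltn ltnSn orbT.
rewrite [X in _ + X]big1 => [|i /andP[/eqP ia /eqP ia1]].
  rewrite addr0 !coefXM /= la mul1r; congr (_ `_ _); lia.
have [lt|ge] := ltnP i a.
  by rewrite [q`_ _]nth_default ?mulr0 // sq; lia.
rewrite coefXM [p`_ _]nth_default ?if_same ?mul0r // sp -/a.
have : (i : nat) <> a by move=> E; apply: ia; apply/val_inj.
have : (i : nat) <> a.+1 by move=> E; apply: ia1; apply/val_inj.
lia.
Qed.

Lemma subcoefX (R : idomainType) (p : {poly R}) k :
  p \is monic -> subcoef (p ^+ k) = subcoef p *+ k.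
Proof.
move=> mp; elim: k => [|k IH]; first by rewrite expr0 subcoef1.
by rewrite exprS subcoefM ?monic_exp // IH mulrS.
Qed.

Lemma subcoef_map (F : fieldType) (R : nzRingType) (f : {rmorphism F -> R}) p :
  subcoef (map_poly f p) = f (subcoef p).
Proof. by rewrite /subcoef size_map_poly -(map_polyX f) -rmorphM coef_map. Qed.

Lemma monic_dvd_irreducible_exp (F : fieldType) (p c : {poly F}) n :
  p \is monic -> irreducible_poly p -> c \is monic -> c %| p ^+ n ->
  exists k, c = p ^+ k.
Proof.
move=> mp ip; elim: n c => [|n IH] c mc.
  rewrite expr0 dvdp1 => /size_poly1P[z _ cz]; exists 0%N; rewrite expr0.
  by move/monicP: mc; rewrite cz lead_coefC => ->.
have [pc|npc] := boolP (p %| c).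
  have /dvdpP[d cd] := pc.
  have md : d \is monic by rewrite -(monicMr d mp) -cd.
  rewrite cd exprSr dvdp_mul2r ?monic_neq0 // => /(IH _ md) [k ->].
  by exists k.+1; rewrite exprSr.
rewrite exprS Gauss_dvdpr; first exact: IH.
by rewrite coprimep_sym irreducible_poly_coprime.
Qed.

(* In M_n(F)[x] the polynomial p(x) - p(A) is a multiple of x - A; take
   determinants. *)
Lemma char_poly_dvd_exp (F : fieldType) n (A : 'M[F]_n.+1) (p : {poly F}) :
  horner_mx A p = 0 -> char_poly A %| p ^+ n.+1.
Proof.
move=> pA0.
have : root (map_poly scalar_mx p) A.
  by rewrite /root; apply/eqP; exact: pA0.
case/factor_theorem => q pq.
have [phi [bphi phiZ phiC _]] := mx_poly_ring_isom F n.
have [psi phiK psiK] := bphi.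
have pE : p%:M = psi q * char_poly_mx A.
  apply: (can_inj phiK); rewrite rmorphM psiK phiZ pq; congr (_ * _).
  by rewrite rmorphB phiC phiZ map_polyX.
have := congr1 determinant pE; rewrite det_scalar -mulmxE det_mulmx => ->.
exact: dvdp_mull.
Qed.

Lemma mulmx_horner_eigen (E : fieldType) n (A : 'M[E]_n.+1) (z : 'rV_n.+1) x p :
  z *m A = x *: z -> z *m horner_mx A p = p.[x] *: z.
Proof.
move=> zA; elim/poly_ind: p => [|p c IH].
  by rewrite rmorph0 mulmx0 horner0 scale0r.
rewrite rmorphD rmorphM /= horner_mx_C horner_mx_X mulmxDr -mulmxE mulmxA IH.
rewrite -scalemxAl zA scalerA mul_mx_scalar -scalerDl.
by rewrite hornerD hornerM hornerX hornerC.
Qed.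

(* The row z plays the role of a family spanning F[x_1, ..., x_k] over F, and
   the matrices that of the multiplications by the x_i. *)
Lemma common_eigenrow (F E : fieldType) (f : {rmorphism F -> E}) (s : seq E) :
  (forall x, x \in s -> exists2 p : {poly F}, p \is monic & root (map_poly f p) x) ->
  exists n (z : 'rV[E]_n), z != 0 /\
    forall x, x \in s -> exists X : 'M[F]_n, z *m map_mx f X = x *: z.
Proof.
elim: s => [|x s IH] alg_s.
  exists 1%N, (const_mx 1); split => //; apply/eqP => /matrixP/(_ 0 0).
  by rewrite !mxE => /eqP; rewrite oner_eq0.
have [|n [z [z0 zs]]] := IH; first by move=> y ys; apply: alg_s; rewrite inE ys orbT.
have [p mp px] := alg_s x (mem_head _ _).
have : eigenvalue (map_mx f (companionmx p)) x.
  by rewrite eigenvalue_root_char -map_char_poly companionmxK.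
case/eigenvalueP => w wC w0.
have lin_mulmxrE (m r q : nat) (B : 'M[F]_(r, q)) :
    map_mx f (lin_mx (@mulmxr F m r q B)) = lin_mx (@mulmxr E m r q (map_mx f B)).
  by apply: map_lin_mx => A; rewrite /= map_mxM.
have lin_mulmxE (m r q : nat) (B : 'M[F]_(m, r)) :
    map_mx f (lin_mx (@mulmx F m r q B)) = lin_mx (@mulmx E m r q (map_mx f B)).
  by apply: map_lin_mx => A; rewrite /= map_mxM.
exists (n * (size p).-1)%N, (mxvec (z^T *m w)); split.
  rewrite mxvec_eq0; have /rV0Pn[i zi] := z0; have /rV0Pn[j wj] := w0.
  apply/eqP => /matrixP/(_ i j); rewrite !mxE big_ord1 !mxE => /eqP.
  by rewrite mulf_eq0 (negPf zi) (negPf wj).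
move=> y; rewrite inE => /predU1P[->|ys].
  exists (lin_mx (mulmxr (companionmx p))); rewrite lin_mulmxrE mul_vec_lin /=.
  by rewrite -mulmxA wC -scalemxAr linearZ.
have [X zX] := zs y ys; exists (lin_mx (mulmx X^T)).
rewrite lin_mulmxE mul_vec_lin /= mulmxA -map_trmx -trmx_mul zX linearZ /=.
by rewrite -scalemxAl linearZ.
Qed.

(** A relation v over F between the entries of z puts z in the E-span of an F-basis B of the kernel
    of v. The coordinates of z in B form a shorter row with the same eigenvalues, for the matrices B
    X B' with B' a pseudo-inverse of B; descent on the length. *)
Lemma common_free_eigenrow (F E : fieldType) (f : {rmorphism F -> E})
    (s : seq E) n (z : 'rV[E]_n) :
  z != 0 -> (forall x, x \in s -> exists X : 'M[F]_n, z *m map_mx f X = x *: z) ->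
  exists m (b : 'rV[E]_m), [/\ b != 0,
    (forall x, x \in s -> exists X : 'M[F]_m, b *m map_mx f X = x *: b) &
    forall v : 'cV[F]_m, b *m map_mx f v = 0 -> v = 0].
Proof.
have [k] := ubnP n; elim: k n z => // k IH n z nk z0 zs.
have [zfree|] := pselect (forall v : 'cV[F]_n, z *m map_mx f v = 0 -> v = 0).
  by exists n, z; split.
move=> /existsNP[v /not_implyP[zv0 /eqP v0]].
pose B := row_base (kermx v).
have Bfree : row_free B by apply: row_base_free.
have zB : (z <= map_mx f B)%MS.
  have /submxP[D kE] : (kermx v <= B)%MS by rewrite eq_row_base.
  have : (z <= map_mx f (kermx v))%MS by rewrite map_kermx; apply/sub_kermxP.
  by move/submx_trans; apply; rewrite [in X in (X <= _)%MS]kE map_mxM submxMl.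
have [c cE] : {c | c = z *m pinvmx (map_mx f B)} by exists (z *m pinvmx (map_mx f B)).
have cB : c *m map_mx f B = z by rewrite cE mulmxKpV.
rewrite -map_pinvmx in cE.
apply: (IH _ c).
- rewrite mxrank_ker; have : (0 < \rank v)%N by rewrite lt0n mxrank_eq0.
  by have := rank_leq_row v; lia.
- by apply: contraNneq z0 => c0; rewrite -cB c0 mul0mx.
- move=> x xs; have [X zX] := zs x xs; exists (B *m X *m pinvmx B).
  by rewrite (map_mxM f _ (pinvmx B)) (map_mxM f B) !mulmxA cB zX -scalemxAl cE.
Qed.

Lemma mulmx_map_free (F E : fieldType) (f : {rmorphism F -> E}) m n
    (b : 'rV[E]_m) (M : 'M[F]_(m, n)) :
  (forall v : 'cV[F]_m, b *m map_mx f v = 0 -> v = 0) ->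
  b *m map_mx f M = 0 -> M = 0.
Proof.
move=> bfree bM; apply/matrixP => i j.
have /matrixP/(_ i 0) : col j M = 0; last by rewrite !mxE.
by apply: bfree; rewrite map_col colE mulmxA bM mul0mx.
Qed.

(* Averaging over conjugates sends a root of p_i to -subcoef p_i / deg p_i; the
   normalised trace of multiplication matrices does this without Galois theory. *)
Lemma linear_relation_traces (F E : fieldType) (f : {rmorphism F -> E})
    (I : finType) (p : I -> {poly F}) (x : I -> E) (l : I -> F) :
  (forall n, n.+1%:R != 0 :> F) ->
  (forall i, p i \is monic) -> (forall i, irreducible_poly (p i)) ->
  (forall i, root (map_poly f (p i)) (x i)) ->
  \sum_i f (l i) * x i = 0 ->
  \sum_i l i * (subcoef (p i) / (size (p i)).-1%:R) = 0.
Proof.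
move=> char0 mp ip px rel.
have [y|n [z [z0 zs]]] := @common_eigenrow F E f (codom x).
  by case/codomP => i ->; exists (p i).
have [m [b [b0 bs bfree]]] := common_free_eigenrow z0 zs.
case: m b b0 bs bfree => [|m] b b0 bs bfree; first by rewrite thinmx0 eqxx in b0.
have /fin_all_exists[X bX] : forall i, exists X : 'M[F]_m.+1,
    b *m map_mx f X = x i *: b by move=> i; apply: bs; apply: codom_f.
have pX i : horner_mx (X i) (p i) = 0.
  apply: (mulmx_map_free bfree).
  rewrite map_horner_mx (mulmx_horner_eigen _ (bX i)).
  by move/eqP: (px i) => ->; rewrite scale0r.
have relX : \sum_i l i *: X i = 0.
  apply: (mulmx_map_free bfree); rewrite map_mx_sum mulmx_sumr.
  rewrite (eq_bigr (fun i => (f (l i) * x i) *: b)); last first.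
    by move=> i _; rewrite map_mxZ -scalemxAr bX scalerA.
  by rewrite -scaler_suml rel scale0r.
(* The characteristic polynomial of [X i] divides a power of the irreducible [p i], so it is
   [p i ^+ k]. Its degree and its [subcoef] are k times those of [p i], and k cancels. *)
have trX i : subcoef (p i) / (size (p i)).-1%:R = - \tr (X i) / m.+1%:R.
  have [k ck] := monic_dvd_irreducible_exp (mp i) (ip i) (char_poly_monic _)
    (char_poly_dvd_exp (pX i)).
  have mk : m.+1 = ((size (p i)).-1 * k)%N.
    by rewrite -size_exp -ck size_char_poly.
  have sub_c : subcoef (char_poly (X i)) = - \tr (X i).
    by rewrite -char_poly_trace // /subcoef size_char_poly coefXM.
  rewrite -sub_c ck subcoefX // mk natrM.
  have k0 : k%:R != 0 :> F by case: k mk {ck} => [|k _]; [rewrite muln0|exact: char0].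
  by rewrite -[subcoef _ *+ k]mulr_natr -mulf_div mulfV ?mulr1.
under eq_bigr => i _ do rewrite trX mulrA mulrN -mxtraceZ.
by rewrite -mulr_suml sumrN -raddf_sum relX raddf0 oppr0 mul0r.
Qed.

(** * Irreducibility over the field generated by a transcendental number *)

(** The field rat(Q). Denominators are unrestricted: division by 0 yields 0, which belongs to the
    field anyway. *)
Definition rational_in (R : numFieldType) (Q : R) : {pred R} := fun x =>
  `[< exists p q : {poly rat},
        x = (map_poly ratr p).[Q] / (map_poly ratr q).[Q] >].

Lemma rational_inP (R : numFieldType) (Q x : R) : x \in rational_in Q <->
  exists (p q : {poly rat}), (map_poly ratr q).[Q] != 0 /\
    x = (map_poly ratr p).[Q] / (map_poly ratr q).[Q].
Proof.
split=> [/asboolP[p [q ->]]|[p [q [_ ->]]]]; last by apply/asboolP; exists p, q.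
have [q0|q0] := eqVneq ((map_poly ratr q).[Q]) 0; last by exists p, q.
by exists 0, 1; rewrite q0 invr0 mulr0 rmorph0 rmorph1 horner0 hornerC mul0r oner_neq0.
Qed.

Lemma rational_in_divring_closed (R : numFieldType) (Q : R) :
  divring_closed (rational_in Q).
Proof.
split=> [|x y|x y].
- by apply/rational_inP; exists 1, 1; rewrite rmorph1 hornerC divr1 oner_neq0.
- move=> /rational_inP[p [q [q0 ->]]] /rational_inP[p' [q' [q'0 ->]]].
  apply/rational_inP; exists (p * q' - p' * q), (q * q').
  rewrite !(rmorphB, rmorphM) /= !hornerE mulf_neq0 //; split => //.
  by field; rewrite q0 q'0.
move=> /rational_inP[p [q [q0 ->]]] /rational_inP[p' [q' [q'0 ->]]].
apply/asboolP; exists (p * q'), (q * p').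
by rewrite !rmorphM /= !hornerM invf_div mulf_div.
Qed.

HB.instance Definition _ (R : numFieldType) (Q : R) :=
  GRing.isDivringClosed.Build R (rational_in Q) (rational_in_divring_closed Q).

Record ratfield (R : numFieldType) (Q : R) :=
  RatField { ratfield_val :> R; _ : ratfield_val \in rational_in Q }.

HB.instance Definition _ (R : numFieldType) (Q : R) :=
  [isSub for (@ratfield_val R Q)].
HB.instance Definition _ (R : numFieldType) (Q : R) :=
  [Choice of ratfield Q by <:].
HB.instance Definition _ (R : numFieldType) (Q : R) :=
  [SubChoice_isSubIntegralDomain of ratfield Q by <:].
HB.instance Definition _ (R : numFieldType) (Q : R) :=
  [SubIntegralDomain_isSubField of ratfield Q by <:].

Lemma rational_in_Q (R : numFieldType) (Q : R) : Q \in rational_in Q.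
Proof.
apply/asboolP; exists 'X, 1.
by rewrite map_polyX rmorph1 hornerX hornerC divr1.
Qed.

Lemma ratfield_natr_neq0 (R : numFieldType) (Q : R) n : n.+1%:R != 0 :> ratfield Q.
Proof.
apply/eqP => n0; have /eqP := rmorph_nat (\val : ratfield Q -> R) n.+1.
by rewrite n0 rmorph0 eq_sym pnatr_eq0.
Qed.

Lemma ratfield_poly (R : numFieldType) (Q : R) (P : {poly R}) :
  P \is a polyOver (rational_in Q) ->
  exists p : {poly ratfield Q}, map_poly (\val : ratfield Q -> R) p = P.
Proof.
move=> /polyOverP PQ; exists (\poly_(i < size P) RatField (PQ i)).
apply/polyP => i; rewrite coef_map coef_poly /=.
case: ltnP => // /leq_sizeP/(_ i (leqnn _)) ->.
exact: (rmorph0 (\val : ratfield Q -> R)).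
Qed.

(** Modulo f only the term j = 0 survives, so f, being prime to c, divides [B 0], which is too small
    unless it is 0. Dividing the rest by f, the argument repeats. *)
Lemma coprimep_homogeneous_eq0 (f c : {poly rat}) J (B : nat -> {poly rat}) :
  coprimep f c -> f != 0 -> (forall j, size (B j) < size f)%N ->
  \sum_(j < J) f ^+ j * c ^+ (J.-1 - j) * B j = 0 ->
  forall j, (j < J)%N -> B j = 0.
Proof.
move=> fc f0; elim: J B => // J IH B sB.
rewrite big_ord_recl expr0 mul1r subn0 /= => sum0.
pose T := \sum_(j < J) f ^+ j * c ^+ (J.-1 - j) * B j.+1.
have TE : c ^+ J * B 0%N + f * T = 0.
  rewrite -[RHS]sum0 /T mulr_sumr; congr (_ + _); apply: eq_bigr => j _.
  rewrite /bump /= add1n exprS !mulrA; congr (_ * _ ^+ _ * _); have := ltn_ord j; lia.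
have B0 : B 0%N = 0.
  apply/eqP; apply: contraTT (sB 0%N) => B0; rewrite -leqNgt dvdp_leq //.
  have fcJ : coprimep f (c ^+ J) by apply: coprimep_expr.
  rewrite -(Gauss_dvdpr _ fcJ) -(dvdp_addl _ (dvdp_mulr T (dvdpp f))).
  by rewrite TE dvdp0.
have T0 : T = 0.
  by apply/eqP; move/eqP: TE; rewrite B0 mulr0 add0r mulf_eq0 (negPf f0).
by case=> [//|j]; rewrite ltnS; apply: (IH (fun j => B j.+1)).
Qed.

Lemma algebraic_horner_rat (R : realType) (p : {poly rat}) (x : R) :
  algebraicOver (ratr : rat -> R) x ->
  algebraicOver (ratr : rat -> R) (map_poly ratr p).[x].
Proof.
move=> /integral_algebraic algx; apply/integral_algebraic.
apply: integral_horner => // _ /(nthP 0)[i ltip <-].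
by rewrite coef_map; apply/integral_algebraic/algebraic_id.
Qed.

(** f and c have no common root, so c(x) is nonzero and Q = f(x) / c(x) would be algebraic along
    with x. *)
Lemma transcendental_root (R : realType) (Q x : R) (f c : {poly rat}) :
  transcendental Q -> coprimep f c ->
  (map_poly ratr f).[x] = Q * (map_poly ratr c).[x] -> transcendental x.
Proof.
move=> trQ fc fx algx; apply: trQ.
have [c0|c0] := eqVneq ((map_poly ratr c).[x]) 0.
  have := coprimep_root (R := R) (p := map_poly ratr f) (q := map_poly ratr c) (x := x).
  by rewrite coprimep_map fc rootE fx c0 mulr0 => /(_ isT (eqxx _)) /eqP [].
have -> : Q = (map_poly ratr f).[x] / (map_poly ratr c).[x] by rewrite fx mulfK.
by apply: algebraic_div; apply: algebraic_horner_rat.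
Qed.

(* If A has root x and Q = f(x) / c(x), then clearing denominators in the
   coefficients of A, which are rational functions of Q, gives a polynomial
   relation for the transcendental number x. *)
Lemma ratfield_root_size (R : realType) (Q x : R) (f c : {poly rat})
    (A : {poly ratfield Q}) :
  transcendental Q -> coprimep f c -> f != 0 ->
  (map_poly ratr f).[x] = Q * (map_poly ratr c).[x] ->
  A != 0 -> root (map_poly (\val : ratfield Q -> R) A) x ->
  (size f <= size A)%N.
Proof.
move=> trQ fc f0 fx A0 Ax; rewrite leqNgt; apply: contra A0 => sA.
have trx := transcendental_root trQ fc fx.
pose n := size A.
have /choice[pq pqP] : forall i, exists pq : {poly rat} * {poly rat},
    (map_poly ratr pq.2).[Q] != 0 /\
    \val A`_i = (map_poly ratr pq.1).[Q] / (map_poly ratr pq.2).[Q].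
  move=> i; have /rational_inP[p [q ?]] : \val A`_i \in rational_in Q by apply: valP.
  by exists (p, q).
pose D := \prod_(i < n) (pq i).2.
have DQ : (map_poly ratr D).[Q] != 0.
  rewrite rmorph_prod horner_prod; apply/prodf_neq0 => i _.
  by have [] := pqP i.
pose a (i : nat) := (pq i).1 * \prod_(j < n | (j : nat) != i) (pq j).2.
have aQ i : (i < n)%N -> (map_poly ratr (a i)).[Q] = (map_poly ratr D).[Q] * \val A`_i.
  move=> lt_in; rewrite /a; have [q0 ->] := pqP i.
  have -> : D = (pq i).2 * \prod_(j < n | (j : nat) != i) (pq j).2.
    by rewrite /D (bigD1 (Ordinal lt_in)).
  rewrite !rmorphM /= !hornerM.
  by field.
have aD : \sum_(i < n) (map_poly ratr (a i)).[Q] * x ^+ i = 0.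
  transitivity ((map_poly ratr D).[Q] * (map_poly \val A).[x]); last first.
    by rewrite (rootP Ax) mulr0.
  rewrite [(map_poly \val A).[x]](@horner_coef_wide _ n) ?size_map_poly // mulr_sumr.
  by apply: eq_bigr => i _; rewrite aQ // coef_map mulrA.
(* Regrouping by powers of Q: the coefficient of Q^j is [B j] evaluated at x, and [B j] is smaller
   than f. *)
pose J := \max_(i < n) size (a i).
pose B (j : nat) := \poly_(i < n) (a i)`_j.
have sB j : (size (B j) < size f)%N by apply: leq_ltn_trans sA; apply: size_poly.
have Bx : \sum_(j < J) Q ^+ j * (map_poly ratr (B j)).[x] = 0.
  rewrite -[RHS]aD.
  transitivity (\sum_(j < J) \sum_(i < n) Q ^+ j * (ratr (a i)`_j * x ^+ i)).
    apply: eq_bigr => j _; rewrite -mulr_sumr; congr (_ * _).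
    rewrite (@horner_coef_wide _ n) ?size_map_poly ?size_poly //.
    by apply: eq_bigr => i _; rewrite coef_map coef_poly ltn_ord.
  rewrite exchange_big; apply: eq_bigr => i _ /=.
  rewrite (@horner_coef_wide _ J) ?size_map_poly; last exact: (leq_bigmax i).
  by rewrite mulr_suml; apply: eq_bigr => j _; rewrite coef_map /=; ring.
(* Multiplied by c(x)^(J-1), with Q c(x) = f(x), the relation says that a rational polynomial
   vanishes at the transcendental x. *)
have sum0 : \sum_(j < J) f ^+ j * c ^+ (J.-1 - j) * B j = 0.
  apply/eqP; apply: contra_notT trx => s0.
  exists (\sum_(j < J) f ^+ j * c ^+ (J.-1 - j) * B j) => //.
  apply/rootP; rewrite rmorph_sum horner_sum /=.
  rewrite (eq_bigr (fun j : 'I_J => (map_poly ratr c).[x] ^+ J.-1 *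
      (Q ^+ j * (map_poly ratr (B j)).[x]))); first by rewrite -mulr_sumr Bx mulr0.
  move=> j _; rewrite !rmorphM !rmorphXn /= !hornerM !horner_exp fx exprMn.
  have -> : J.-1 = (j + (J.-1 - j))%N by have := ltn_ord j; lia.
  rewrite exprD addKn; move: (Q ^+ j) (_ ^+ j) (_ ^+ (J.-1 - j)) => s t w.
  by move: (_.[x]) => y; ring.
have B0 := coprimep_homogeneous_eq0 fc f0 sB sum0.
apply/eqP/polyP => i; rewrite coef0; have [lt_in|ge_in] := ltnP i n; last first.
  by rewrite nth_default.
have ai0 : a i = 0.
  apply/polyP => j; rewrite coef0; have [ltj|gej] := ltnP j J.
    by have /polyP/(_ i) := B0 j ltj; rewrite coef_poly lt_in coef0.
  apply: nth_default; apply: leq_trans gej; exact: (leq_bigmax (Ordinal lt_in)).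
have := aQ i lt_in; rewrite ai0 rmorph0 horner0 => /esym/eqP.
by rewrite mulf_eq0 (negPf DQ) /= => /eqP ?; apply: val_inj; rewrite rmorph0.
Qed.

(** Of two factors of P one vanishes at x. By [ratfield_root_size] it is at least as large as f,
    hence as P, so the other factor is constant. *)
Lemma ratfield_irreducible (R : realType) (Q x : R) (f c : {poly rat})
    (P : {poly ratfield Q}) :
  transcendental Q -> coprimep f c -> f \is monic -> (size c < size f)%N ->
  map_poly \val P = map_poly ratr f - Q *: map_poly ratr c ->
  root (map_poly (\val : ratfield Q -> R) P) x -> irreducible_poly P.
Proof.
move=> trQ fc mf scf PE Px; have f0 := monic_neq0 mf.
have fx : (map_poly ratr f).[x] = Q * (map_poly ratr c).[x].
  by move/rootP: Px; rewrite PE hornerD hornerN hornerZ => /subr0_eq.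
have sP : size P = size f.
  rewrite -(size_map_poly (\val : ratfield Q -> R)) PE size_polyDl ?size_map_poly //.
  rewrite size_polyN; apply: leq_ltn_trans (size_scale_leq _ _) _.
  by rewrite size_map_poly.
have P0 : P != 0 by rewrite -size_poly_eq0 sP size_poly_eq0.
split.
  have /root_size_gt1 : map_poly (\val : ratfield Q -> R) P != 0 by rewrite map_poly_eq0.
  by move/(_ _ Px); rewrite size_map_poly.
move=> q sq qP; have /dvdpP[d Pdq] := qP.
have [d0 q0] : d != 0 /\ q != 0 by apply/andP; rewrite -negb_or -mulf_eq0 -Pdq.
have : root (map_poly \val (d * q)) x by rewrite -Pdq.
rewrite rmorphM rootM => /orP[] /(ratfield_root_size trQ fc f0 fx) => [/(_ d0)|/(_ q0)].
  rewrite -sP Pdq size_mul // => le_d; case/negP: sq; rewrite eqn_leq.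
  move: q0 d0 le_d; rewrite -!size_poly_gt0.
  by move: (size d) (size q) => [//|a] [//|b]; lia.
rewrite -sP => le_q; rewrite -dvdp_size_eqp // eqn_leq le_q andbT.
exact: dvdp_leq.
Qed.

(** * Recurrence of trigonometric sums *)

Definition cis (R : realType) (x : R) : R[i] := (cos x +i* sin x)%C.

Lemma cisD (R : realType) (x y : R) : cis (x + y) = cis x * cis y.
Proof.
by rewrite /cis cosD sinD; apply/eqP; rewrite eq_complex /= eqxx addrC mulrC eqxx.
Qed.

Lemma cis0 (R : realType) : cis (0 : R) = 1.
Proof. by rewrite /cis cos0 sin0. Qed.

Lemma cis_sum (R : realType) (I : finType) (x : I -> R) :
  cis (\sum_i x i) = \prod_i cis (x i).
Proof. exact: (big_morph _ (@cisD R) (@cis0 R)). Qed.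

Definition sqnormc (R : realType) (z : R[i]) : R := complex.Re z ^+ 2 + complex.Im z ^+ 2.

Lemma sqnormcM (R : realType) (z w : R[i]) : sqnormc (z * w) = sqnormc z * sqnormc w.
Proof. by case: z w => [a b] [c d]; rewrite /sqnormc /=; ring. Qed.

Lemma sqnormcX (R : realType) (z : R[i]) k : sqnormc (z ^+ k) = sqnormc z ^+ k.
Proof.
elim: k => [|k IH]; last by rewrite !exprS sqnormcM IH.
by rewrite !expr0 /sqnormc /= expr1n expr0n addr0.
Qed.

Lemma sqnormc_ge0 (R : realType) (z : R[i]) : 0 <= sqnormc z.
Proof. by rewrite addr_ge0 ?sqr_ge0. Qed.

Lemma sum_cis (R : realType) (I : finType) (c w : I -> R) :
  \sum_i (c i)%:C%C * cis (w i) =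
  ((\sum_i c i * cos (w i)) +i* (\sum_i c i * sin (w i)))%C.
Proof.
apply/eqP; rewrite eq_complex; apply/andP; split; apply/eqP => /=.
  rewrite (big_morph (@complex.Re R) (id1 := 0) (op1 := +%R)) //; last by case=> ? ? [].
  by apply: eq_bigr => i _; rewrite /= mul0r subr0.
rewrite (big_morph (@complex.Im R) (id1 := 0) (op1 := +%R)) //; last by case=> ? ? [].
by apply: eq_bigr => i _; rewrite /= mul0r addr0.
Qed.

Lemma sqnormc_sum_cis (R : realType) (I : finType) (c w : I -> R) :
  sqnormc (\sum_i (c i)%:C%C * cis (w i)) =
  \sum_(p : I * I) c p.1 * c p.2 * cos (w p.1 - w p.2).
Proof.
rewrite sum_cis /sqnormc /= !expr2 !big_distrlr /= -big_split /=.
under eq_bigr do rewrite -big_split /=; rewrite pair_big /=.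
by apply: eq_bigr => -[i j] _ /=; rewrite cosB; ring.
Qed.

Lemma sum_cis_exp (R : realType) (I : finType) (c w : I -> R) k :
  (\sum_i (c i)%:C%C * cis (w i)) ^+ k =
  \sum_(f : {ffun 'I_k -> I}) (\prod_j c (f j))%:C%C * cis (\sum_j w (f j)).
Proof.
rewrite -[in LHS](card_ord k) -prodr_const bigA_distr_bigA /=.
apply: eq_bigr => f _; rewrite cis_sum big_split /=; congr (_ * _).
by rewrite rmorph_prod.
Qed.

(** Multiplication by 2 sin(b/2) makes the sum telescope. *)
Lemma sum_cos_arith (R : realType) (a b : R) J :
  (\sum_(j < J) cos (a + j%:R * b)) * (sin (b / 2) *+ 2) =
  sin (a + J%:R * b - b / 2) - sin (a - b / 2).
Proof.
elim: J => [|J IH]; first by rewrite big_ord0 !mul0r addr0 subrr.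
rewrite big_ord_recr /= mulrDl IH.
have -> : a + J.+1%:R * b - b / 2 = (a + J%:R * b) + b / 2.
  by rewrite -natr1; field.
by rewrite [in RHS]sinD [sin (a + _ - _)]sinB; ring.
Qed.

(* Means along an arithmetic progression whose step is too small to create
   resonances replace the usual means over long intervals. *)
Lemma trig_sum_mean_le (R : realType) (K : finType) (d w : K -> R) (T M : R) :
  (forall t, T <= t -> \sum_k d k * cos (t * w k) <= M) ->
  \sum_(k | w k == 0) d k <= M.
Proof.
(* With this step |s w_k| <= 1, so sin(s w_k / 2) vanishes only for w_k = 0. *)
move=> bound; pose s := (1 + \sum_k `|w k|)^-1.
have s0 : 0 < s by rewrite invr_gt0 ltr_pwDl // sumr_ge0.
have sw k : `|s * w k| <= 1.
  rewrite normrM (gtr0_norm s0) mulrC ler_pdivrMr; last by rewrite -invr_gt0.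
  rewrite mul1r (bigD1 k) //= addrCA lerDl addr_ge0 //; exact: sumr_ge0.
have sin_neq0 k : w k != 0 -> sin (s * w k / 2) != 0.
  move=> wk; rewrite -normr_gt0.
  have wlog_pos (x : R) : 0 < x -> x <= 1 -> 0 < sin (x / 2).
    move=> x0 x1; apply: sin_gt0_pi; rewrite divr_gt0 //=.
    by apply: lt_le_trans (pi_ge2 R); rewrite ltr_pdivrMr //; lra.
  have swk : s * w k != 0 by rewrite mulf_neq0 // gt_eqF.
  have [pos|neg] := ltrP 0 (s * w k).
    by rewrite normr_gt0 gt_eqF // wlog_pos // -(gtr0_norm pos).
  have {}neg : 0 < - (s * w k) by rewrite oppr_gt0 lt_neqAle swk.
  rewrite -normrN -sinN -mulNr normr_gt0 gt_eqF // wlog_pos //.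
  by rewrite -(gtr0_norm neg) normrN.
(* Over J sample points the nonzero frequencies contribute at most [C] in absolute value, whatever
   J, while the zero frequency grows linearly in J. *)
pose C := \sum_(k | w k != 0) `|d k| * `|sin (s * w k / 2)|^-1.
have partial J : J%:R * (\sum_(k | w k == 0) d k - M) <= C.
  have : \sum_(j < J) \sum_k d k * cos ((T + j%:R * s) * w k) <= J%:R * M.
    rewrite mulr_natl -[X in _ <= _ *+ X]card_ord -sumr_const; apply: ler_sum => j _.
    by apply: bound; rewrite lerDl mulr_ge0 // ltW.
  rewrite exchange_big (bigID (fun k => w k == 0)) /=.
  have -> : \sum_(k | w k == 0) \sum_(j < J) d k * cos ((T + j%:R * s) * w k) =
            J%:R * \sum_(k | w k == 0) d k.
    rewrite mulr_sumr; apply: eq_bigr => k /eqP ->.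
    rewrite (eq_bigr (fun=> d k)) => [|j _]; last by rewrite mulr0 cos0 mulr1.
    by rewrite sumr_const card_ord mulr_natl.
  suff : - C <= \sum_(k | w k != 0) \sum_(j < J) d k * cos ((T + j%:R * s) * w k).
    by rewrite mulrBr; lra.
  rewrite /C -sumrN; apply: ler_sum => k wk; rewrite -mulr_sumr.
  rewrite lerNl (le_trans (ler_norm _)) // normrN normrM ler_wpM2l //.
  rewrite -[leRHS]mul1r ler_pdivlMr ?normr_gt0 ?sin_neq0 //.
  rewrite -normrM; under eq_bigr do rewrite mulrDl -mulrA.
  have := sum_cos_arith (T * w k) (s * w k) J.
  set X := \sum_(j < J) _; set A := _ + _ - _; set B := T * w k - _ => XE.
  have -> : X * sin (s * w k / 2) = (sin A - sin B) / 2.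
    by rewrite -XE; field.
  have := sin_le1 A; have := sin_geN1 A; have := sin_le1 B; have := sin_geN1 B.
  by rewrite ler_norml => *; apply/andP; split; lra.
rewrite leNgt; apply/negP; rewrite -subr_gt0 => gap.
have C0 : 0 <= C by apply: sumr_ge0 => k _; rewrite mulr_ge0 // invr_ge0.
by have := archi_boundP (divr_ge0 C0 (ltW gap)); rewrite ltr_pdivrMr // ltNge partial.
Qed.

(** For r > 0 write r = exp(-(n+1) kap). As exp(k kap) >= k kap, it is enough that (2k)^n < (k
    kap)^(n+1), which holds once k kap^(n+1) > 2^n. *)
Lemma polynomial_mul_geometric_lt1 (R : realType) (r : R) n :
  0 <= r < 1 -> exists k, k.+1%:R ^+ n * r ^+ k < 1.
Proof.
move=> /andP[]; rewrite le_eqVlt => /predU1P[<- _|r0 r1].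
  by exists 1%N; rewrite expr1 mulr0.
have [kap kap0 rE] : exists2 kap, 0 < kap & r = expR (- kap) ^+ n.+1.
  exists (- ln r / n.+1%:R); first by rewrite divr_gt0 // oppr_gt0 ln_lt0 // r0.
  by rewrite -expRM_natl mulrN mulrCA mulfV ?pnatr_eq0 // mulr1 opprK lnK.
pose k := (Num.bound (2 ^+ n / kap ^+ n.+1)).+1.
have kbig : 2 ^+ n < k%:R * kap ^+ n.+1.
  rewrite -ltr_pdivrMr ?exprn_gt0 //.
  apply: lt_le_trans (archi_boundP _) _; last by rewrite ler_nat leqnSn.
  by rewrite divr_ge0 // exprn_ge0 // ltW.
exists k; rewrite rE -exprM mulnC exprM -expRM_natl mulrN expRN exprVn.
rewrite ltr_pdivrMr ?exprn_gt0 ?expR_gt0 // mul1r.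
apply: (@lt_le_trans _ _ ((k%:R * kap) ^+ n.+1)); last first.
  rewrite lerXn2r ?nnegrE ?mulr_ge0 ?expR_ge0 ?(ltW kap0) //.
  by rewrite (le_trans _ (expR_ge1Dx _)) // lerDr.
apply: (@le_lt_trans _ _ ((2 * k%:R) ^+ n)).
  by rewrite lerXn2r ?nnegrE // -natrM ler_nat /k; lia.
rewrite exprMn [ltRHS]exprMn [k%:R ^+ n.+1]exprS mulrAC.
by rewrite ltr_pM2r // exprn_gt0 // ltr0n.
Qed.

(** Cauchy-Schwarz, obtained by expanding the squares (S t - 1/N)^2. *)
Lemma sum_sqr_ge_invcard (R : realType) (T : finType) (S : T -> R) :
  \sum_t S t = 1 -> 1 <= #|T|%:R * \sum_t S t ^+ 2.
Proof.
move=> S1; pose N : R := #|T|%:R.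
have N0 : 0 < N.
  rewrite ltr0n lt0n; apply: contra_eq_neq S1 => T0.
  by rewrite big_pred0 ?(eq_sym 0) ?oner_neq0 // => t; have := card0_eq T0 t.
have : 0 <= \sum_t (S t - N^-1) ^+ 2 by apply: sumr_ge0 => t _; apply: sqr_ge0.
rewrite (eq_bigr (fun t => S t ^+ 2 + (- (N^-1 *+ 2) * S t + N^-1 ^+ 2))); last first.
  by move=> t _; ring.
rewrite !big_split /= -mulr_sumr S1 mulr1 sumr_const -[X in _ + (_ + X)]mulr_natl -/N => h.
rewrite -ler_pdivrMl // mulr1; apply: le_trans (_ : _ <= N^-1) _ => //.
move: h; have -> : N * N^-1 ^+ 2 = N^-1 by field; rewrite gt_eqF.
lra.
Qed.

(* If frequencies agree only for words with the same number of negative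
   weights, then nothing cancels in the frequency expansion of the k-th power of
   the sum; grouping words by letter counts, of which there are polynomially
   many in k, bounds the mean of its square norm below. *)
Lemma trig_sum_recurrence (R : realType) (I : finType) (c lam : I -> R) (r T : R) :
  \sum_i `|c i| = 1 ->
  (forall k (w w' : 'I_k -> I),
     (forall j, c (w j) != 0) -> (forall j, c (w' j) != 0) ->
     \sum_j lam (w j) = \sum_j lam (w' j) ->
     (\sum_j (c (w j) < 0)%R = \sum_j (c (w' j) < 0)%R)%N) ->
  r < 1 ->
  exists2 t, T <= t & r < sqnormc (\sum_i (c i)%:C%C * cis (t * lam i)).
Proof.
move=> c1 coh r1; apply: contrapT => /forall2NP small.
have {}small t : T <= t -> sqnormc (\sum_i (c i)%:C%C * cis (t * lam i)) <= r.
  by move=> Tt; have [//|/negP] := small t; rewrite -leNgt.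
have r0 : 0 <= r by apply: le_trans (small T (lexx _)); apply: sqnormc_ge0.
(* The mean for the k-th power is at most r^k, while grouping words gives at least (k+1)^(-#|I|);
   this k makes the two bounds incompatible. *)
have [k] := @polynomial_mul_geometric_lt1 R r #|I| (introT andP (conj r0 r1)).
apply/negP; rewrite -leNgt.
pose cw (f : {ffun 'I_k -> I}) := \prod_j c (f j).
pose lw (f : {ffun 'I_k -> I}) := \sum_j lam (f j).
pose neg (f : {ffun 'I_k -> I}) := (\sum_j (c (f j) < 0)%R)%N.
have cwE f : cw f = (-1) ^+ neg f * `|cw f|.
  rewrite /cw normr_prod /neg -prodrXr -big_split /=.
  by apply: eq_bigr => j _; rewrite -realEsign // num_real.
have cwneq0 f : cw f != 0 -> forall j, c (f j) != 0.
  by move=> /prodf_neq0 cf j; apply: cf.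
have coh2 f g : lw f = lw g -> cw f * cw g = `|cw f| * `|cw g|.
  move=> fg; have [->|f0] := eqVneq (cw f) 0; first by rewrite normr0 !mul0r.
  have [->|g0] := eqVneq (cw g) 0; first by rewrite normr0 !mulr0.
  rewrite cwE [cw g]cwE !normrM !normrX !normrN1 !expr1n !mul1r !normr_id.
  have -> : neg f = neg g by apply: coh => //; apply: cwneq0.
  by rewrite mulrACA -expr2 -exprM mulnC exprM sqrrN expr1n expr1n mul1r.
have mean : \sum_(p | lw p.1 - lw p.2 == 0) cw p.1 * cw p.2 <= r ^+ k.
  apply: (@trig_sum_mean_le R _ (fun p => cw p.1 * cw p.2) (fun p => lw p.1 - lw p.2) T).
  move=> t Tt; apply: le_trans (lerXn2r k _ _ (small t Tt)); rewrite ?nnegrE ?sqnormc_ge0 //.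
  rewrite -sqnormcX sum_cis_exp sqnormc_sum_cis le_eqVlt; apply/orP; left.
  apply/eqP/eq_bigr => p _; congr (_ * cos _).
  by rewrite mulrBr !mulr_sumr.
(* Letter counts determine the frequency, and take at most (k+1)^#|I| values. [inord] is exact, a
   count being at most k. *)
pose ty (f : {ffun 'I_k -> I}) : {ffun I -> 'I_k.+1} :=
  [ffun i => inord #|[pred j | f j == i]|].
have lw_ty f g : ty f = ty g -> lw f = lw g.
  have lwE h : lw h = \sum_i lam i *+ #|[pred j | h j == i]|.
    rewrite /lw (partition_big h predT) //=; apply: eq_bigr => i _.
    by rewrite -sumr_const; apply: eq_bigr => j /eqP ->.
  move=> fg; rewrite !lwE; apply: eq_bigr => i _; congr (_ *+ _).
  have /ffunP/(_ i) := fg; rewrite !ffunE => /(congr1 (@nat_of_ord _)).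
  by rewrite !inordK // ltnS (leq_trans (max_card _)) ?card_ord.
pose S (t : {ffun I -> 'I_k.+1}) := \sum_(f | ty f == t) `|cw f|.
have S1 : \sum_t S t = 1.
  transitivity (\sum_f `|cw f|); first by rewrite (partition_big ty predT).
  rewrite -[RHS](expr1n _ k) -c1.
  rewrite -[in RHS](card_ord k) -prodr_const bigA_distr_bigA /=.
  by apply: eq_bigr => f _; rewrite normr_prod.
have := sum_sqr_ge_invcard S1; rewrite card_ffun card_ord natrX => ge1.
apply: le_trans ge1 _; rewrite ler_wpM2l ?exprn_ge0 //; apply: le_trans mean.
under eq_bigr => t _ do rewrite expr2 /S big_distrlr /= pair_big_dep /=.
rewrite (exchange_big_dep (fun p => ty p.1 == ty p.2)) /=; last first.
  by move=> t p _ /andP[/eqP -> /eqP ->].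
(* Pairs with equal frequency but different letter counts contribute nonnegative terms and may be
   dropped. *)
rewrite [leRHS](bigID (fun p => ty p.1 == ty p.2)) /=.
apply: le_trans (_ : _ <=
  \sum_(p | (lw p.1 - lw p.2 == 0) && (ty p.1 == ty p.2)) cw p.1 * cw p.2) _.
  rewrite le_eqVlt; apply/orP; left; apply/eqP; apply: eq_big => [p|p /eqP pp].
    by apply/idP/andP => [/eqP pp|[]//]; split=> //; [rewrite (lw_ty _ _ pp) subrr|apply/eqP].
  rewrite (big_pred1 (ty p.1)) => [|t]; last by rewrite /= -pp andbb eq_sym.
  by rewrite coh2 //; apply: lw_ty.
rewrite lerDl; apply: sumr_ge0 => p /andP[pp _].
by rewrite coh2 ?mulr_ge0 //; apply/eqP; rewrite -subr_eq0.
Qed.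

Lemma limf_esup_pinfty_eq1 (R : realType) (g : R -> R) :
  (forall t, g t <= 1) -> (forall r T, r < 1 -> exists2 t, T <= t & r < g t) ->
  limf_esup (fun t => (g t)%:E) +oo%R = 1%E.
Proof.
move=> g1 grec; rewrite limf_esupE; apply/eqP; rewrite eq_le; apply/andP; split.
  apply: (@le_trans _ _ (ereal_sup ((fun t => (g t)%:E) @` setT))).
    by apply: ereal_inf_lbound; exists setT => //; apply: filterT.
  by apply: ge_ereal_sup => _ [t _ <-]; rewrite lee_fin.
apply: le_ereal_inf_tmp => _ [A [M [_ MA]] <-].
apply/lee_subgt0Pr => eps eps0.
have [|t Mt rt] := grec (1 - eps) (M + 1); first by lra.
apply: le_trans (_ : _ <= (g t)%:E)%E _; first by rewrite -EFinB lee_fin ltW.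
by apply: ereal_sup_ubound; exists t => //; apply: MA; lra.
Qed.

(** * The transfer amplitude *)

Local Open Scope classical_set_scope.

Lemma cvg_mx (K : numFieldType) m n (u : nat -> 'M[K]_(m, n)) (L : 'M[K]_(m, n)) :
  (forall i j, (fun k => u k i j) @ \oo --> L i j) -> u @ \oo --> L.
Proof.
move=> cvgu; apply/cvg_ballP => e e0.
have : \forall k \near \oo, forall i j, ball (L i j) e (u k i j).
  apply: filter_forall => i; apply: filter_forall => j.
  by have /cvg_ballP := cvgu i j; apply.
by apply: filterS => k ball_k; split.
Qed.

Lemma cvg_sum_numField (K : numFieldType) (I : Type) (r : seq I)
    (u : I -> nat -> K) (l : I -> K) :
  (forall i, u i @ \oo --> l i) ->
  (fun k => \sum_(i <- r) u i k) @ \oo --> \sum_(i <- r) l i.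
Proof.
move=> cvgu; elim: r => [|i r IH].
  by rewrite big_nil; under eq_fun do rewrite big_nil; apply: cvg_cst.
by rewrite big_cons; under eq_fun do rewrite big_cons; apply: cvgD.
Qed.

Lemma mxexp_diagonalizable (K : numFieldType) n (P P' : 'M[K]_n) (d E : 'I_n -> K) :
  P *m P' = 1%:M -> P' *m P = 1%:M ->
  (forall j, series (fun k => (k`!%:R)^-1 * d j ^+ k) @ \oo --> E j) ->
  mxexp (P' *m diag_mx (\row_j d j) *m P) = P' *m diag_mx (\row_j E j) *m P.
Proof.
move=> PP' P'P cvgE; set A := P' *m _ *m P.
have AX k : A ^+ k = P' *m diag_mx (\row_j d j ^+ k) *m P.
  elim: k => [|k IH].
    rewrite expr0 (_ : \row_j _ = const_mx 1); last by apply/rowP => j; rewrite !mxE.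
    by rewrite diag_const_mx mulmx1 P'P.
  rewrite exprS IH /A -mulmxE !mulmxA -[_ *m P *m P']mulmxA PP' mulmx1.
  congr (_ *m _); rewrite -[LHS]mulmxA mulmx_diag.
  by congr (_ *m diag_mx _); apply/rowP => j; rewrite !mxE exprS.
have entry (e : 'I_n -> K) i j :
    (P' *m diag_mx (\row_l e l) *m P) i j = \sum_l P' i l * P l j * e l.
  rewrite mxE; apply: eq_bigr => l _; rewrite mul_mx_diag !mxE; ring.
apply/cvg_lim => //; apply: cvg_mx => i j.
have -> : (fun k => series (fun k => (k`!%:R)^-1 *: A ^+ k) k i j) =
    (fun k => \sum_l P' i l * P l j * series (fun k => (k`!%:R)^-1 * d l ^+ k) k).
  apply/funext => k; rewrite /series /= summxE.
  under [RHS]eq_bigr do rewrite mulr_sumr.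
  rewrite exchange_big; apply: eq_bigr => r _ /=.
  by rewrite mxE AX entry mulr_sumr; apply: eq_bigr => l _; ring.
by rewrite entry; apply: cvg_sum_numField => l; apply: cvgM; [apply: cvg_cst|apply: cvgE].
Qed.

Lemma cvg_complex (R : realType) (u v : nat -> R) (a b : R) :
  u @ \oo --> a -> v @ \oo --> b ->
  (fun n => (u n +i* v n)%C : (R[i] : numFieldType)) @ \oo -->
  ((a +i* b)%C : (R[i] : numFieldType)).
Proof.
move=> /cvgrPdist_lt ua /cvgrPdist_lt vb; apply/cvgrPdist_lt => -[e e'] /=.
rewrite ltcE /= => /andP[/eqP -> e0]; have e20 : 0 < e / 2 by rewrite divr_gt0.
near=> n; have un : `|a - u n| < e / 2 by near: n; apply: ua.
have vn : `|b - v n| < e / 2 by near: n; apply: vb.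
rewrite -[(_ - _)%R]/((a - u n) +i* (b - v n))%C.
apply: (@le_lt_trans _ _ (`|a - u n| + `|b - v n|)%:C%C); last first.
  by rewrite ltcR [ltRHS]splitr ltrD.
rewrite lecR; move: (a - _) (b - _) => p q.
rewrite -[leRHS]ger0_norm ?addr_ge0 // -sqrtr_sqr ler_wsqrtr //.
rewrite sqrrD !real_normK ?num_real // addrAC lerDl.
by rewrite mulrn_wge0 // mulr_ge0.
Unshelve. all: by end_near. Qed.

Lemma series_exp_cis (R : realType) (x : R) :
  series (fun k => (k`!%:R)^-1 * (0 +i* x)%C ^+ k : (R[i] : numFieldType))
    @ \oo --> (cis x : (R[i] : numFieldType)).
Proof.
have -> : series (fun k => (k`!%:R)^-1 * (0 +i* x)%C ^+ k : (R[i] : numFieldType)) =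
    (fun n => (series (cos_coeff x) n +i* series (sin_coeff x) n)%C).
  apply/funext => n; rewrite /series /=; elim: n => [|n IH]; first by rewrite !big_geq.
  rewrite !big_nat_recr //= IH -[RHS]/((_ +i* _)%C + (_ +i* _)%C); congr (_ + _).
  have -> : (0 +i* x)%C ^+ n = 
    ((~~ odd n)%:R * (-1) ^+ n./2 * x ^+ n +i* ((odd n)%:R * (-1) ^+ n.-1./2 * x ^+ n))%C :> R[i].
    elim: n {IH} => [|n IH]; first by rewrite !expr0 /= !mulr1.
    rewrite exprS IH -[LHS]/(_ +i* _)%C !mul0r sub0r add0r /=.
    case on: (odd n); rewrite /= ?(mul0r, mul1r, mulr0, oppr0).
      congr (_ +i* _)%C; case: n on {IH} => // n _ /=.
      by rewrite !exprS; ring.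
    by congr (_ +i* _)%C; rewrite exprS; ring.
  have -> : n`!%:R = (n`!%:R)%:C%C :> R[i] by rewrite (rmorph_nat (real_complex R)).
  rewrite -fmorphV.
  rewrite -[LHS]/(_ +i* _)%C !mul0r subr0 addr0 /cos_coeff /sin_coeff /= -?exprnP.
  by congr (_ +i* _)%C; ring.
rewrite /cis cos.unlock sin.unlock; apply: cvg_complex.
  exact: is_cvg_series_cos_coeff.
exact: is_cvg_series_sin_coeff.
Qed.

Lemma real_complex_real (R : realType) (r : R) : (r%:C)%C \is Num.real.
Proof. by rewrite realE -[0]/(0%:C)%C !lecR -realE num_real. Qed.

Lemma sqnormcE (R : realType) (z : R[i]) : ((sqnormc z)%:C)%C = z * Num.conj z.
Proof.
rewrite -normCK /sqnormc; case: z => a b.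
rewrite -[`|_|]/((Num.sqrt (a ^+ 2 + b ^+ 2))%:C)%C -rmorphXn /= sqr_sqrtr //.
by rewrite addr_ge0 ?sqr_ge0.
Qed.

Lemma normc_sqnormc (R : realType) (z : R[i]) : Normc.normc z = Num.sqrt (sqnormc z).
Proof. by case: z. Qed.

(** A real symmetric matrix is Hermitian, so the complex spectral theorem applies with real
    eigenvalues. The eigenvectors in P may be complex. *)
Lemma real_symmetric_spectral (R : realType) n (N : 'M[R]_n) : N^T = N ->
  exists (P : 'M[R[i]]_n) (lam : 'I_n -> R),
  let P' := map_mx Num.conj P^T in
  [/\ P *m P' = 1%:M, P' *m P = 1%:M &
      map_mx (real_complex R) N = P' *m diag_mx (\row_j (lam j)%:C%C) *m P].
Proof.
move=> NT; set A := map_mx (real_complex R) N.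
have hA : A \is hermitianmx n false Num.conj.
  apply/is_hermitianmxP; rewrite expr0 scale1r; apply/matrixP => i j.
  by rewrite !mxE (CrealP (real_complex_real _)) -[in RHS]NT mxE.
have uP := spectral_unitarymx A.
have AE : A = _ := orthomx_spectralP (hermitian_normalmx hA).
have /mxOverP dreal := hermitian_spectral_diag_real hA.
exists (spectralmx A), (fun j => complex.Re (spectral_diag A 0 j)); split.
- exact/unitarymxP.
- by apply: mulmx1C; apply/unitarymxP.
rewrite (_ : \row_j _ = spectral_diag A); first by rewrite -invmx_unitary.
apply/rowP => j; rewrite !mxE; have := dreal 0 j; case: (spectral_diag A 0 j) => a b.
by rewrite realE !lecE /= (eq_sym 0 b) => /orP[] /andP[/eqP -> _].
Qed.

(** The spectral expansion has weights conj(P_la) P_lb, possibly complex. As N is its own transpose,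
    the conjugate weights give the same entry; the average of both is (|P_la + P_lb|^2 - |P_la -
    P_lb|^2) / 4 by polarization. *)
Lemma exp_imaginary_symmetric_entry (R : realType) n (N : 'M[R]_n) (P : 'M[R[i]]_n)
    (lam : 'I_n -> R) (t : R) (a b : 'I_n) : N^T = N ->
  let P' := map_mx Num.conj P^T in
  P *m P' = 1%:M -> P' *m P = 1%:M ->
  map_mx (real_complex R) N = P' *m diag_mx (\row_j (lam j)%:C%C) *m P ->
  mxexp ((0 +i* t)%C *: map_mx (real_complex R) N) a b =
  \sum_(p : bool * 'I_n)
    ((-1) ^+ p.1 * (sqnormc (P p.2 a + (-1) ^+ p.1 * P p.2 b) / 4))%:C%C * cis (t * lam p.2).
Proof.
move=> NT P' PP' P'P NE.
have cvgE j : series (fun k => (k`!%:R)^-1 * (0 +i* (t * lam j))%C ^+ k :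
    (R[i] : numFieldType)) @ \oo --> (cis (t * lam j) : (R[i] : numFieldType)).
  exact: series_exp_cis.
have scaleE (X Y : 'M[R[i]]_n) : (0 +i* t)%C *: (X *m diag_mx (\row_j (lam j)%:C%C) *m Y) =
    X *m diag_mx (\row_j (0 +i* (t * lam j))%C) *m Y.
  rewrite scalemxAl scalemxAr; congr (_ *m _ *m _); apply/matrixP => i j.
  rewrite !mxE mulrnAr; congr (_ *+ _).
  by rewrite -[LHS]/(_ +i* _)%C !mul0r mulr0 subr0 add0r.
have entry (X Y : 'M[R[i]]_n) i j :
    (X *m diag_mx (\row_l cis (t * lam l)) *m Y) i j = \sum_l X i l * Y l j * cis (t * lam l).
  rewrite mxE; apply: eq_bigr => l _; rewrite mul_mx_diag !mxE; ring.
have E1 := mxexp_diagonalizable PP' P'P cvgE.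
have NE2 : map_mx (real_complex R) N = P^T *m diag_mx (\row_j (lam j)%:C%C) *m P'^T.
  rewrite -[in LHS]NT -map_trmx NE !trmx_mul tr_diag_mx mulmxA; done.
have E2 := mxexp_diagonalizable (K := R[i]) (P := P'^T) (P' := P^T) _ _ cvgE.
have {}E2 := E2 (etrans (esym (trmx_mul _ _)) (etrans (congr1 trmx PP') (trmx1 _ _)))
  (etrans (esym (trmx_mul _ _)) (etrans (congr1 trmx P'P) (trmx1 _ _))).
set X := mxexp _.
have X1 : X a b = \sum_l Num.conj (P l a) * P l b * cis (t * lam l).
  by rewrite /X NE scaleE E1 entry; apply: eq_bigr => l _; rewrite !mxE.
have X2 : X a b = \sum_l P l a * Num.conj (P l b) * cis (t * lam l).
  by rewrite /X NE2 scaleE E2 entry; apply: eq_bigr => l _; rewrite !mxE.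
apply: (@mulIf _ 4%:R); first by rewrite pnatr_eq0.
transitivity ((X a b + X a b) * 2); first by ring.
rewrite {1}X1 X2 -big_split /=.
rewrite -(pair_bigA _ (fun (s : bool) j => ((-1) ^+ s *
  (sqnormc (P j a + (-1) ^+ s * P j b) / 4))%:C%C * cis (t * lam j))) /= big_bool -big_split /=.
rewrite !mulr_suml; apply: eq_bigr => l _ /=; rewrite expr0 !expr1 !mul1r !mulN1r.
rewrite rmorphN !rmorphM /= !fmorphV (rmorph_nat (real_complex R) 4) !sqnormcE.
by rewrite rmorphB rmorphD /=; move: (Num.conj _) (Num.conj _) (cis _) => x y z; field.
Qed.

(* An eigenvector g of the Hamiltonian enters the amplitude with the two real
   weights +-|g u +- g v|^2 / 4; the absolute values of all weights add up to 1.
   A letter (s, j) of a word stands for the sign (-1)^s and the j-th eigenvector. *)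
Lemma PGST_eigenvectors (R : realType) (V : finType) (e : V -> V -> nat) (u v : V) (Q : R) :
  (forall x y, e x y = e y x) ->
  exists n (g : 'I_n -> V -> R[i]) (lam : 'I_n -> R),
  [/\ forall j z, \sum_x g j x * (e x z)%:R + (Q * ((z == u) || (z == v))%:R)%:C%C * g j z =
        (lam j)%:C%C * g j z,
      forall x z, \sum_j Num.conj (g j x) * g j z = (x == z)%:R &
      (forall k (w w' : 'I_k -> bool * 'I_n),
        (forall l, g (w l).2 u + (-1) ^+ (w l).1 * g (w l).2 v != 0) ->
        (forall l, g (w' l).2 u + (-1) ^+ (w' l).1 * g (w' l).2 v != 0) ->
        \sum_l lam (w l).2 = \sum_l lam (w' l).2 ->
        (\sum_l (w l).1 = \sum_l (w' l).1)%N) ->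
      induces_PGST e u v Q].
Proof.
move=> eC; set N := hamiltonian e u v Q.
have NT : N^T = N.
  apply/matrixP => i j; rewrite !mxE eC; congr (_ + Q * _).
  by case: (eqVneq i j) => [->|ij]; rewrite ?eqxx // eq_sym (negPf ij).
have [P [lam [PP' P'P NE]]] := real_symmetric_spectral NT.
have orth x z :
    \sum_j Num.conj (P j (enum_rank x)) * P j (enum_rank z) = (x == z)%:R.
  have /matrixP/(_ (enum_rank x) (enum_rank z)) := P'P.
  by rewrite !mxE (inj_eq enum_rank_inj) => <-; apply: eq_bigr => j _; rewrite !mxE.
exists #|V|, (fun j x => P j (enum_rank x)), lam; split.
- move=> j z; have : P *m map_mx (real_complex R) N = diag_mx (\row_j (lam j)%:C%C) *m P.
    by rewrite NE !mulmxA PP' mul1mx.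
  move/matrixP/(_ j (enum_rank z)); rewrite mul_diag_mx !mxE => <-.
  rewrite (reindex (@enum_rank V)) /=; last exact: onW_bij (enum_rank_bij V).
  transitivity (\sum_x P j (enum_rank x) * ((e x z)%:R +
      (Q * ((z == u) || (z == v))%:R)%:C%C * (x == z)%:R)).
    under [RHS]eq_bigr do rewrite mulrDr; rewrite big_split /=; congr (_ + _).
    rewrite (bigD1 z) //= eqxx big1 => [|x /negPf ->]; last by rewrite !mulr0.
    by rewrite addr0 mulr1 mulrC.
  apply: eq_bigr => x _; congr (_ * _); rewrite !mxE !enum_rankK rmorphD rmorph_nat.
  congr (_ + _); rewrite (inj_eq enum_rank_inj).
  rewrite !inE; case: (eqVneq x z) => [->|_]; rewrite ?mulr1n ?mulr0n ?mulr1 ?mulr0 //.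
- exact: orth.
move=> coh; pose c (p : bool * 'I_#|V|) := (-1) ^+ p.1 *
  (sqnormc (P p.2 (enum_rank u) + (-1) ^+ p.1 * P p.2 (enum_rank v)) / 4).
have amp t : transfer_amplitude e u v Q t = \sum_p (c p)%:C%C * cis (t * lam p.2).
  exact: exp_imaginary_symmetric_entry.
have normcE p : `|c p| =
    sqnormc (P p.2 (enum_rank u) + (-1) ^+ p.1 * P p.2 (enum_rank v)) / 4.
  by rewrite normrM normrX normrN1 expr1n mul1r ger0_norm // divr_ge0 ?sqnormc_ge0.
(* Parallelogram identity, with the unit norm of the columns of P at u and v. *)
have c1 : \sum_p `|c p| = 1.
  apply: (complexI (R := R)); rewrite rmorph_sum rmorph1 /=.
  apply: (@mulIf _ 2%:R); first by rewrite pnatr_eq0.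
  have sum2 : \sum_j (Num.conj (P j (enum_rank u)) * P j (enum_rank u) +
      Num.conj (P j (enum_rank v)) * P j (enum_rank v)) = 2.
    by rewrite big_split /= !orth !eqxx.
  rewrite mul1r -[RHS]sum2 mulr_suml.
  rewrite (eq_bigr (fun p => (`|c (p.1, p.2)|)%:C%C * 2)); last by case.
  rewrite -(pair_bigA _ (fun s j => (`|c (s, j)|)%:C%C * 2)) /= big_bool -big_split /=.
  apply: eq_bigr => j _; rewrite !normcE /= !rmorphM !fmorphV /=.
  rewrite (rmorph_nat (real_complex R) 4) !sqnormcE expr0 expr1 mulN1r mul1r.
  by rewrite rmorphB rmorphD /=; move: (Num.conj _) (Num.conj _) => x y; field.
have amp1 t : sqnormc (transfer_amplitude e u v Q t) <= 1.
  rewrite amp sqnormc_sum_cis -[leRHS](mulr1 1) -{1}c1 -c1 big_distrlr pair_bigA /=.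
  apply: ler_sum => p _; apply: le_trans (ler_norm _) _; rewrite !normrM.
  by apply: ler_piMr; [apply: mulr_ge0|apply: cos_max].
apply: limf_esup_pinfty_eq1 => [t|r T r1].
  by rewrite normc_sqnormc -sqrtr1 ler_wsqrtr.
have cneq0 p : c p != 0 ->
    P p.2 (enum_rank u) + (-1) ^+ p.1 * P p.2 (enum_rank v) != 0.
  apply: contraNneq => p0; rewrite -normr_eq0 normcE p0 /sqnormc /=.
  by rewrite expr0n addr0 mul0r.
have c_lt0 p : c p != 0 -> (c p < 0)%R = p.1.
  move=> cp; have := cp; rewrite -normr_gt0 normcE => wp; rewrite /c.
  move: wp; move: (sqnormc _ / 4) => x x0.
  by case: (p.1) => /=; rewrite ?expr1 ?expr0 ?mulN1r ?mul1r ?oppr_lt0 // lt_gtF.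
have [k w w' cw cw' ww'||t Tt rt] := @trig_sum_recurrence R _ c (fun p => lam p.2) r T c1.
- rewrite (eq_bigr (fun l => (w l).1 : nat)) => [|l _]; last by rewrite c_lt0.
  rewrite [RHS](eq_bigr (fun l => (w' l).1 : nat)) => [|l _]; last by rewrite c_lt0.
  by apply: coh => // l; apply: cneq0.
- exact: r1.
(* Recurrence is known for the squared modulus x, and x <= sqrt x because 0 <= x <= 1. *)
exists t => //; rewrite normc_sqnormc; apply: lt_le_trans rt _; rewrite -amp.
set x := sqnormc _; have x1 : x <= 1 by apply: amp1.
have x0 : 0 <= x by apply: sqnormc_ge0.
by rewrite -[leLHS](sqr_sqrtr x0) expr2 ler_piMr ?sqrtr_ge0 // -sqrtr1 ler_wsqrtr.
Qed.

Local Close Scope classical_set_scope.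

(** * Resolvents of a pair of vertices *)

Lemma sumr_indicator (A : nzRingType) (T : finType) (F : T -> A) (u : T) :
  \sum_x F x * (x == u)%:R = F u.
Proof.
rewrite (bigD1 u) //= eqxx mulr1 big1 ?addr0 // => x /negPf ->.
by rewrite mulr0.
Qed.

(* y / f is the image of b_u + (-1)^s b_v under the resolvent of the adjacency
   matrix, where b_u, b_v are basis vectors; adding the potential Q only changes f to f - Q c. *)
Definition resolvent_at (V : finType) (e : V -> V -> nat) (u v : V) (s : bool)
    (f c : {poly rat}) : Prop :=
  exists y : V -> {poly rat},
  [/\ forall x, 'X * y x - \sum_z (e x z)%:R * y z =
        f * ((x == u)%:R + (-1) ^+ s * (x == v)%:R),
      y u = c & y v = (-1) ^+ s * c].

(* All poles of c / (f - Q c) are simple, since it is a sum of w_j / (x - lam_j)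
   with w_j >= 0; so dividing f - Q c by its common factor with c keeps the
   eigenvalues with w_j != 0 among the roots. *)
Lemma resolvent_at_root (R : realType) (V : finType) (e : V -> V -> nat) (u v : V)
    (Q : R) (s : bool) (d f c : {poly rat}) n (g : 'I_n -> V -> R[i]) (lam : 'I_n -> R) i :
  u != v -> d != 0 -> resolvent_at e u v s (d * f) (d * c) ->
  (forall j z, \sum_x g j x * (e x z)%:R + (Q * ((z == u) || (z == v))%:R)%:C%C * g j z =
        (lam j)%:C%C * g j z) ->
  (forall x z, \sum_j Num.conj (g j x) * g j z = (x == z)%:R) ->
  g i u + (-1) ^+ s * g i v != 0 ->
  root (map_poly ratr f - Q *: map_poly ratr c) (lam i).
Proof.
move=> uv d0 [y [yE yu yv]] eig orth bi.
pose M (p : {poly rat}) := map_poly (real_complex R) (map_poly ratr p).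
have MD p q : M (p + q) = M p + M q by rewrite /M !rmorphD.
have MB p q : M (p - q) = M p - M q by rewrite /M !rmorphB.
have MM p q : M (p * q) = M p * M q by rewrite /M !rmorphM.
have Mnat k : M k%:R = k%:R by rewrite /M !rmorph_nat.
have Msum (F : V -> {poly rat}) : M (\sum_z F z) = \sum_z M (F z).
  by rewrite /M !rmorph_sum.
have Msgn : M ((-1) ^+ s) = (-1) ^+ s by rewrite /M !rmorph_sign.
have MX : M 'X = 'X by rewrite /M !map_polyX.
have M0 p : (M p == 0) = (p == 0) by rewrite /M !map_poly_eq0.
pose beta j := g j u + (-1) ^+ s * g j v.
pose G j := \sum_x (g j x)%:P * M (y x).
pose F := M (d * f) - (Q%:C)%C%:P * M (d * c).
have yM x : 'X * M (y x) = \sum_z (e x z)%:R * M (y z) +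
    M (d * f) * ((x == u)%:R + (-1) ^+ s * (x == v)%:R).
  rewrite -[LHS](subrK (\sum_z (e x z)%:R * M (y z))) addrC; congr (_ + _).
  have := congr1 M (yE x); rewrite MB (MM 'X) MX Msum (MM (d * f)) MD Mnat.
  rewrite (MM (_ ^+ s)) Msgn Mnat => <-; congr (_ - _).
  by apply: eq_bigr => z _; rewrite MM Mnat.
(* The equation for y is paired with an eigenvector of the Hamiltonian. The potential acts only at u
   and v, where y is known, and turns f into f - Q c. *)
have claim1 j : ('X - ((lam j)%:C)%C%:P) * G j = F * (beta j)%:P.
  have eigP z : \sum_x (g j x)%:P * (e x z)%:R =
      ((lam j)%:C)%C%:P * (g j z)%:P -
      (Q%:C)%C%:P * (g j z)%:P * ((z == u)%:R + (z == v)%:R).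
    have -> : \sum_x (g j x)%:P * (e x z)%:R = (\sum_x g j x * (e x z)%:R)%:P.
      by rewrite rmorph_sum /=; apply: eq_bigr => x _; rewrite polyCM polyC_natr.
    have -> : \sum_x g j x * (e x z)%:R = (lam j)%:C%C * g j z -
        (Q * ((z == u) || (z == v))%:R)%:C%C * g j z by rewrite -eig addrK.
    have -> : (z == u)%:R + (z == v)%:R = ((z == u) || (z == v))%:R :> {poly R[i]}.
      by case: (eqVneq z u) => [->|_]; rewrite ?(negPf uv) ?addr0 ?add0r.
    rewrite rmorphM rmorph_nat /= polyCB !polyCM polyC_natr; ring.
  have -> : ('X - ((lam j)%:C)%C%:P) * G j =
      \sum_x (g j x)%:P * ('X * M (y x)) - ((lam j)%:C)%C%:P * G j.
    by rewrite mulrBl mulr_sumr; congr (_ - _); apply: eq_bigr => x _; ring.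
  under eq_bigr do rewrite yM mulrDr.
  rewrite big_split /=.
  have -> : \sum_x (g j x)%:P * \sum_z (e x z)%:R * M (y z) =
      \sum_z (\sum_x (g j x)%:P * (e x z)%:R) * M (y z).
    under eq_bigr do rewrite mulr_sumr.
    rewrite exchange_big; apply: eq_bigr => z _; rewrite mulr_suml.
    by apply: eq_bigr => x _; rewrite mulrA.
  have -> : \sum_x (g j x)%:P * (M (d * f) * ((x == u)%:R + (-1) ^+ s * (x == v)%:R)) =
      M (d * f) * (beta j)%:P.
    transitivity (\sum_x (M (d * f) * (g j x)%:P * (x == u)%:R +
        M (d * f) * (-1) ^+ s * (g j x)%:P * (x == v)%:R)).
      by apply: eq_bigr => x _; ring.
    rewrite big_split /= !sumr_indicator polyCD polyCM rmorph_sign; ring.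
  have -> : \sum_z (\sum_x (g j x)%:P * (e x z)%:R) * M (y z) =
      ((lam j)%:C)%C%:P * G j - (Q%:C)%C%:P * M (d * c) * (beta j)%:P.
    under eq_bigr do rewrite eigP mulrBl.
    rewrite big_split /= sumrN; congr (_ - _).
      by rewrite mulr_sumr; apply: eq_bigr => z _; rewrite mulrA.
    transitivity (\sum_z ((Q%:C)%C%:P * (g j z)%:P * M (y z) * (z == u)%:R +
        (Q%:C)%C%:P * (g j z)%:P * M (y z) * (z == v)%:R)).
      by apply: eq_bigr => z _; ring.
    rewrite big_split /= !sumr_indicator yu yv !MM Msgn polyCD polyCM rmorph_sign; ring.
  by rewrite /F; ring.
(* The eigenvectors resolve the identity, so the sum is y u + (-1)^s y v = 2 d c. *)
have claim2 : \sum_j (Num.conj (beta j))%:P * G j = 2%:R * M (d * c).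
  transitivity (\sum_x (\sum_j (Num.conj (beta j) * g j x)%:P) * M (y x)).
    under eq_bigr do rewrite mulr_sumr.
    rewrite exchange_big; apply: eq_bigr => x _; rewrite mulr_suml.
    by apply: eq_bigr => j _; rewrite polyCM mulrA.
  have orthP x : \sum_j (Num.conj (beta j) * g j x)%:P =
      (x == u)%:R + (-1) ^+ s * (x == v)%:R.
    rewrite -rmorph_sum /=.
    have -> : \sum_j Num.conj (beta j) * g j x = (u == x)%:R + (-1) ^+ s * (v == x)%:R.
      rewrite -!orth mulr_sumr -big_split; apply: eq_bigr => j _ /=.
      by rewrite rmorphD rmorphM rmorph_sign /= mulrDl mulrA.
    by rewrite polyCD polyCM rmorph_sign !polyC_natr !(eq_sym x).
  under eq_bigr do rewrite orthP mulrDl.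
  transitivity (\sum_x (M (y x) * (x == u)%:R + (-1) ^+ s * M (y x) * (x == v)%:R)).
    by apply: eq_bigr => x _; ring.
  rewrite big_split /= !sumr_indicator yu yv !MM Msgn signrMK; ring.
(* [r] lists every eigenvalue once. The identity [key] below is 2 c / (f - Q c) = sum_j |beta_j|^2 /
   (X - lam_j) with denominators cleared. *)
pose r := undup (codom (fun j => (lam j)%:C%C)).
pose Mj (a : R[i]) := \prod_(m <- r | m != a) ('X - m%:P).
have rE j : \prod_(m <- r) ('X - m%:P) = ('X - ((lam j)%:C)%C%:P) * Mj (lam j)%:C%C.
  by rewrite (bigD1_seq (lam j)%:C%C) ?undup_uniq // mem_undup codom_f.
have key : \prod_(m <- r) ('X - m%:P) * (2%:R * M c) =
    (M f - (Q%:C)%C%:P * M c) *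
    \sum_j (beta j * Num.conj (beta j))%:P * Mj (lam j)%:C%C.
  apply: (@mulfI _ (M d)); first by rewrite M0.
  transitivity (\prod_(m <- r) ('X - m%:P) * (2%:R * M (d * c))).
    by rewrite MM; ring.
  rewrite -claim2 !mulr_sumr; apply: eq_bigr => j _.
  rewrite (rE j) polyCM.
  transitivity ((Num.conj (beta j))%:P * Mj (lam j)%:C%C * (('X - ((lam j)%:C)%C%:P) * G j)).
    by ring.
  by rewrite claim1 /F !MM; ring.
have /(congr1 (horner^~ (lam i)%:C%C)) := key.
rewrite (rE i) !hornerM hornerXsubC subrr !mul0r => /esym/eqP.
rewrite mulf_eq0 => /orP[|sum0].
  have -> : M f - (Q%:C)%C%:P * M c =
      map_poly (real_complex R) (map_poly ratr f - Q *: map_poly ratr c).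
    by rewrite rmorphB /= map_polyZ mul_polyC.
  by rewrite horner_map fmorph_eq0.
(* At lam_i only the j with lam_j = lam_i survive. Their terms share a nonzero factor and have
   weights |beta_j|^2 >= 0, of which the i-th is positive. *)
exfalso; move: sum0; rewrite horner_sum.
have Mj_eq0 j : lam j != lam i -> (Mj (lam j)%:C%C).[(lam i)%:C%C] = 0.
  move=> ji; apply/eqP; rewrite /Mj horner_prod prodf_seq_eq0; apply/hasP.
  exists (lam i)%:C%C; first by rewrite mem_undup codom_f.
  rewrite hornerXsubC subrr eqxx andbT.
  by apply: contraNneq ji => /complexI ->.
have Mi_neq0 : (Mj (lam i)%:C%C).[(lam i)%:C%C] != 0.
  rewrite /Mj horner_prod prodf_seq_neq0; apply/allP => m _; apply/implyP => mi.
  by rewrite hornerXsubC subr_eq0 eq_sym.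
rewrite (bigID (fun j => lam j == lam i)) /= [X in _ + X]big1 ?addr0 => [|j ji]; last first.
  by rewrite hornerM Mj_eq0 // mulr0.
rewrite (eq_bigr (fun j => beta j * Num.conj (beta j) * (Mj (lam i)%:C%C).[(lam i)%:C%C])).
  rewrite -mulr_suml mulf_eq0 (negPf Mi_neq0) orbF psumr_eq0 => [|j _]; last exact: mul_conjC_ge0.
  by move=> /allP/(_ i (mem_index_enum _)); rewrite eqxx /= mul_conjC_eq0 (negPf bi).
by move=> j /eqP ji; rewrite hornerM hornerC ji.
Qed.

(** Up to sign, the two sides of the inequality are the means of the roots of f_s - Q c_s: c_s is
    monic of degree one less than f_s, which accounts for the -Q, and [size (c s)] is the degree of
    f_s. *)
Lemma PGST_resolvents (R : realType) (V : finType) (e : V -> V -> nat) (u v : V)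
    (Q : R) (d f c : bool -> {poly rat}) :
  is_graph e -> u != v -> transcendental Q ->
  (forall s, d s != 0) ->
  (forall s, resolvent_at e u v s (d s * f s) (d s * c s)) ->
  (forall s, coprimep (f s) (c s)) ->
  (forall s, f s \is monic) -> (forall s, c s \is monic) ->
  (forall s, size (f s) = (size (c s)).+1) ->
  (ratr (subcoef (f true)) - Q) / (size (c true))%:R !=
  (ratr (subcoef (f false)) - Q) / (size (c false))%:R ->
  induces_PGST e u v Q.
Proof.
move=> [eC _] uv trQ d0 res fc mf mc sf neqT.
have [n [g [lam [eig orth]]]] := PGST_eigenvectors u v Q eC.
apply=> k w w' w0 w'0 ww'.
pose PR s := map_poly ratr (f s) - Q *: map_poly ratr (c s).
have sPR s : size (PR s) = size (f s).
  rewrite size_polyDl ?size_map_poly // size_polyN sf ltnS.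
  by apply: leq_trans (size_scale_leq _ _) _; rewrite size_map_poly.
have mPR s : PR s \is monic.
  rewrite monicE lead_coefDl ?lead_coef_map ?(monicP (mf s)) ?rmorph1 //.
  rewrite size_polyN size_map_poly sf ltnS.
  by apply: leq_trans (size_scale_leq _ _) _; rewrite size_map_poly.
have subPR s : subcoef (PR s) = ratr (subcoef (f s)) - Q.
  rewrite -(subcoef_map (ratr : {rmorphism rat -> R})) /subcoef sPR size_map_poly.
  rewrite mulrBr coefB -scalerAr coefZ; congr (_ - _).
  have := monicP (mc s); rewrite sf /= coefXM lead_coefE coef_map.
  have : (0 < size (c s))%N by rewrite size_poly_gt0 monic_neq0.
  by case: (size (c s)) => //= a _ ->; rewrite rmorph1 mulr1.
have PRQ s : PR s \is a polyOver (rational_in Q).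
  apply/polyOverP => i; rewrite coefB coefZ !coef_map /=.
  by apply: rpredB; [apply: rpred_rat|apply: rpredM; [apply: rational_in_Q|apply: rpred_rat]].
have /choice[PF PFE] s := ratfield_poly (PRQ s).
have mPF s : PF s \is monic by have := mPR s; rewrite -PFE map_monic.
have sPF s : size (PF s) = size (f s).
  by rewrite -(size_map_poly (\val : ratfield Q -> R)) PFE sPR.
pose W (p : bool * 'I_k) := if p.1 then w p.2 else w' p.2.
have W0 p : g (W p).2 u + (-1) ^+ (W p).1 * g (W p).2 v != 0 by rewrite /W; case: ifP.
have rootW p : root (PR (W p).1) (lam (W p).2).
  exact: (resolvent_at_root uv (d0 _) (res _) eig orth (W0 p)).
have irrW p : irreducible_poly (PF (W p).1).
  apply: (ratfield_irreducible trQ (fc _) (mf _)); last by rewrite PFE; apply: rootW.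
    by rewrite sf.
  exact: PFE.
have := @linear_relation_traces _ _ (\val : ratfield Q -> R) _
  (fun p => PF (W p).1) (fun p => lam (W p).2) (fun p => (-1) ^+ p.1).
have rootF p : root (map_poly (\val : ratfield Q -> R) (PF (W p).1)) (lam (W p).2).
  by rewrite PFE.
move=> /(_ (@ratfield_natr_neq0 _ _) (fun p => mPF _) irrW rootF).
have rel : \sum_(p : bool * 'I_k) \val ((-1) ^+ p.1 : ratfield Q) * lam (W p).2 = 0.
  rewrite (eq_bigr (fun p : bool * 'I_k => (-1) ^+ p.1 * lam (W (p.1, p.2)).2)); last first.
    by move=> [s l] _; rewrite rmorph_sign.
  rewrite -(pair_bigA _ (fun (s : bool) l => (-1) ^+ s * lam (W (s, l)).2)) /=.
  rewrite big_bool /= expr1 expr0 -!mulr_sumr ww'; ring.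
move=> /(_ rel) /(congr1 (\val : ratfield Q -> R)).
rewrite rmorph_sum rmorph0.
pose tau s := (ratr (subcoef (f s)) - Q) / (size (c s))%:R.
have tauE p : \val (subcoef (PF (W p).1) / (size (PF (W p).1)).-1%:R) = tau (W p).1.
  rewrite fmorph_div rmorph_nat -(subcoef_map (\val : ratfield Q -> R)) PFE subPR.
  by rewrite sPF sf.
rewrite (eq_bigr (fun p : bool * 'I_k => (-1) ^+ p.1 * tau (W (p.1, p.2)).1)); last first.
  by move=> [s l] _; rewrite -tauE rmorphM rmorph_sign.
rewrite -(pair_bigA _ (fun (s : bool) l => (-1) ^+ s * tau (W (s, l)).1)) big_bool /=.
rewrite expr1 expr0 -!mulr_sumr /W /= mulN1r mul1r => /eqP; rewrite addrC subr_eq0.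
(* A letter contributes [tau] of its sign only; as the two values differ, equal totals mean equally
   many negative letters. *)
have tauS (z : 'I_k -> bool * 'I_n) : \sum_l tau (z l).1 =
    k%:R * tau false + (\sum_l (z l).1)%N%:R * (tau true - tau false).
  rewrite natr_sum mulr_suml -[X in X%:R * _](card_ord k) mulr_natl -sumr_const -big_split /=.
  by apply: eq_bigr => l _; case: (z l).1; rewrite ?mulr1n ?mulr0n; ring.
rewrite !tauS (inj_eq (addrI _)) => /eqP/mulIf h; apply/eqP.
rewrite -(eqr_nat R); apply/eqP/esym/h; rewrite subr_eq0; exact: neqT.
Qed.

(** * Gluing a path *)

(* cheb k.+1 is the characteristic polynomial of the path with k nodes. *)
Fixpoint cheb (n : nat) : {poly rat} :=
  match n with
  | 0 => 0
  | m.+1 => match m with 0 => 1 | k.+1 => 'X * cheb m - cheb k end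
  end.

Lemma chebSS n : cheb n.+2 = 'X * cheb n.+1 - cheb n.
Proof. by []. Qed.

(** With X = 2 cos t, [cheb n] is sin(n t) / sin t, and this is a product formula for sines. *)
Lemma cheb_add a b : cheb (a + b).+1 = cheb a.+1 * cheb b.+1 - cheb a * cheb b.
Proof.
elim: a b => [|a IH] b; first by rewrite add0n /= mul1r mul0r subr0.
by rewrite addSnnS IH !chebSS; ring.
Qed.

Lemma cheb_cassini n : cheb n.+1 ^+ 2 - cheb n.+2 * cheb n = 1.
Proof.
elim: n => [|n IH]; first by rewrite /= mulr0 subr0 expr1n.
by rewrite -[RHS]IH (chebSS n.+1) (chebSS n); ring.
Qed.

Lemma coprimep_cheb n : coprimep (cheb n) (cheb n.+1).
Proof.
have := cheb_cassini n; move: (cheb n.+2) (cheb n.+1) (cheb n) => x y z xyz.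
by apply/Bezout_eq1_coprimepP; exists (- x, y); rewrite -[RHS]xyz /=; ring.
Qed.

Lemma dvdp_cheb_mul n j : cheb n %| cheb (j * n).
Proof.
elim: j => [|j IH]; first by rewrite mul0n dvdp0.
rewrite mulSn; case: n IH => [|n] IH; first by rewrite muln0.
rewrite addSn cheb_add dvdp_sub //; first exact: dvdp_mulr.
by rewrite dvdp_mull.
Qed.

(** Suppose that [cheb n.+1] shares a factor g with c. As [cheb n.+1] divides [cheb (j * n.+1)],
    which is prime to its successor, g is prime to [cheb (j * n.+1).+1]. Taking L divisible by n + 1
    thus settles g, and induction treats c / g. *)
Lemma coprimep_cheb_progression (c : {poly rat}) : c != 0 ->
  exists2 L, (0 < L)%N & forall j, coprimep (cheb (j * L).+1) c.
Proof.
have [k] := ubnP (size c); elim: k c => // k IH c; rewrite ltnS => ck c0.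
have [allcop|] := pselect (forall n, coprimep (cheb n.+1) c).
  by exists 1%N => // j; apply: allcop.
move=> /existsNP[n ncop]; pose g := gcdp (cheb n.+1) c.
have g0 : g != 0 by rewrite gcdp_eq0 negb_and c0 orbT.
have /dvdpP[c' cE] : g %| c by apply: dvdp_gcdr.
have c'0 : c' != 0 by apply: contraNneq c0; rewrite cE => ->; rewrite mul0r.
have g1 : (1 < size g)%N.
  move/negP: ncop; rewrite /coprimep -/g; move: g0; rewrite -size_poly_gt0.
  by case: (size g) => [|[]].
have [|//|L L0 cop] := IH c'.
  apply: leq_trans ck; rewrite cE size_mul //; move: g1 c'0.
  by rewrite -size_poly_gt0; move: (size g) (size c') => [|[|a]] // [|b] //; lia.
exists (n.+1 * L)%N => [|j]; first by rewrite muln_gt0.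
rewrite cE coprimepMr mulnA cop /=; apply: coprimep_dvdl (dvdp_gcdl _ _) _.
rewrite coprimep_sym -mulnA mulnCA mulnC.
by apply: coprimep_dvdr (dvdp_cheb_mul n.+1 (j * L)) _; apply: coprimep_cheb.
Qed.

Lemma cheb_lead n : [/\ size (cheb n.+1) = n.+1, cheb n.+1 \is monic &
  (cheb n.+1)`_n.-1 = (n == 0)%:R].
Proof.
have [m] := ubnP n; elim: m n => // m IH [|[|n]] nm.
- by rewrite /= size_poly1 monic1 coef1.
- by rewrite /= mulr1 subr0 size_polyX monicX coefX.
have [s1 m1 c1] := IH n.+1 nm.
have [s0 _ _] := IH n (ltnW nm).
have lt_size : (size (- cheb n.+1)%R < size ('X * cheb n.+2)%R)%N.
  by rewrite size_polyN [_ * cheb n.+2]mulrC size_mulX ?monic_neq0 // s0 s1; lia.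
rewrite chebSS; split.
- by rewrite size_polyDl // [_ * cheb n.+2]mulrC size_mulX ?monic_neq0 // s1.
- by rewrite monicE lead_coefDl // mulrC lead_coefMX -monicE.
- by rewrite coefB coefXM /= c1 nth_default ?subr0 // s0.
Qed.

(** At odd index both polynomials brought in by the glued path have the factor h. Cancelling it
    lowers the added degree from 2m to m, where m = p + 1, and leaves cofactors that depend on the
    sign. *)
Lemma cheb_odd (s : bool) p :
  let h := cheb p.+2 + (-1) ^+ s * cheb p.+1 in
  cheb (p.+1 + p.+1).+1 = h * (cheb p.+2 - (-1) ^+ s * cheb p.+1) /\
  cheb (p.+1 + p.+1) + (-1) ^+ s = h * (cheb p.+1 - (-1) ^+ s * cheb p).
Proof.
have : (-1) ^+ s * (-1) ^+ s = 1 :> {poly rat} by rewrite -expr2 sqrr_sign.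
move: (_ ^+ s) => g g2 h; rewrite /h; split; first by rewrite cheb_add; ring: g2.
by rewrite addSn cheb_add -[g in LHS]mulr1 -(cheb_cassini p); ring: g2.
Qed.

Lemma coprimep_cheb_signed (s : bool) n :
  coprimep (cheb n.+1 - (-1) ^+ s * cheb n) (cheb n.+2 - (-1) ^+ s * cheb n.+1).
Proof.
elim: n => [|n IH]; first by rewrite /= mulr0 subr0 coprime1p.
have -> : cheb n.+3 - (-1) ^+ s * cheb n.+2 =
    'X * (cheb n.+2 - (-1) ^+ s * cheb n.+1) + -1 *: (cheb n.+1 - (-1) ^+ s * cheb n).
  by rewrite scaleN1r (chebSS n.+1) (chebSS n); ring.
by rewrite coprimep_addl_mul coprimepZr ?oppr_eq0 ?oner_eq0 // coprimep_sym.
Qed.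

(** The sign in the second coefficient is what moves the sums of the roots in opposite
    directions. *)
Lemma cheb_signed_lead (s : bool) p :
  let k := cheb p.+2 - (-1) ^+ s * cheb p.+1 in
  [/\ size k = p.+2, k \is monic & subcoef k = - (-1) ^+ s].
Proof.
move=> k; have [s2 m2 c2] := cheb_lead p.+1; have [s1 m1 _] := cheb_lead p.
have sgnE : (-1) ^+ s * cheb p.+1 = (-1) ^+ s *: cheb p.+1.
  by rewrite -mul_polyC rmorph_sign.
have lt_size : (size (- ((-1) ^+ s * cheb p.+1))%R < size (cheb p.+2))%N.
  by rewrite size_polyN sgnE size_scale ?signr_eq0 // s1 s2.
have sk : size k = p.+2 by rewrite size_polyDl.
split=> //; first by rewrite monicE lead_coefDl // -monicE.
rewrite /subcoef sk /= coefXM /= coefB c2 sgnE coefZ.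
by have /monicP := m1; rewrite lead_coefE s1 => ->; rewrite mulr1 sub0r.
Qed.

(** * The resolvent of a graph with a glued path *)

Lemma path_node_inl (V : finType) (u v x : V) p k : (k < p.+2)%N ->
  (path_node u v p.+2 k == inl x) = (k == 0%N) && (x == u).
Proof.
case: k => [_|k]; first by rewrite /= eq_sym.
by rewrite ltnS => lt_k; rewrite /= (insubT (fun j => j < p.+1)%N lt_k).
Qed.

Lemma path_nodeS_inl (V : finType) (u v x : V) p k : (k < p.+2)%N ->
  (path_node u v p.+2 k.+1 == inl x) = (k == p.+1) && (x == v).
Proof.
rewrite ltnS leq_eqVlt => /predU1P[->|lt_k] /=.
  by rewrite insubF ?ltnn // eqxx eq_sym.
by rewrite (insubT (fun j => j < p.+1)%N lt_k) ltn_eqF.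
Qed.

Lemma path_nodeS_inr (V : finType) (u v : V) p k (i : 'I_p.+1) :
  (path_node u v p.+2 k.+1 == inr i) = (k == i).
Proof.
rewrite /=; case: insubP => [j _ jk|/negP ki]; first by rewrite -jk.
by apply/esym/eqP => kE; apply: ki; rewrite kE.
Qed.

Lemma path_node_inr (V : finType) (u v : V) p k (i : 'I_p.+1) :
  (path_node u v p.+2 k == inr i) = (k == i.+1).
Proof. by case: k => [//|k]; rewrite path_nodeS_inr. Qed.

Lemma path_node_neqS (V : finType) (u v : V) p k : u != v -> (k < p.+2)%N ->
  path_node u v p.+2 k != path_node u v p.+2 k.+1.
Proof.
move=> uv kp; case ke : (path_node u v p.+2 k.+1) => [x|i].
  rewrite path_node_inl //; have /eqP := ke; rewrite path_nodeS_inl //.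
  by move=> /andP[/eqP-> /eqP ->]; rewrite /= .
have /eqP := ke; rewrite path_nodeS_inr path_node_inr => /eqP ->.
by rewrite ltn_eqF.
Qed.

(** A node sees its successor and its predecessor on the path. The [||] in [glue_path] splits into a
    sum because consecutive nodes are distinct. *)
Lemma glue_path_sum (V : finType) (e : V -> V -> nat) (u v : V) p
    (Y : V + 'I_p.+1 -> {poly rat}) (a : V + 'I_p.+1) : u != v ->
  \sum_b (glue_path e u v p.+2 a b)%:R * Y b =
  (if a is inl x then \sum_z (e x z)%:R * Y (inl z) else 0) +
  (\sum_(k < p.+2) Y (path_node u v p.+2 k.+1) * (path_node u v p.+2 k == a)%:R +
   \sum_(k < p.+2) Y (path_node u v p.+2 k) * (path_node u v p.+2 k.+1 == a)%:R).
Proof.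
move=> uv; rewrite /glue_path; under eq_bigr do rewrite natrD mulrDl.
rewrite big_split /=; congr (_ + _).
  rewrite big_sumType /= [X in _ + X]big1 ?addr0; last by case: a => [x|i] j _; rewrite mul0r.
  by case: a => [//|i]; rewrite big1 // => x _; rewrite mul0r.
under eq_bigr do rewrite natr_sum mulr_suml.
rewrite exchange_big -big_split; apply: eq_bigr => k _ /=.
have kk := path_node_neqS uv (ltn_ord k).
transitivity (\sum_b ((path_node u v p.+2 k == a)%:R * Y b * (b == path_node u v p.+2 k.+1)%:R +
    (path_node u v p.+2 k.+1 == a)%:R * Y b * (b == path_node u v p.+2 k)%:R)).
  apply: eq_bigr => b _; rewrite !(eq_sym b).
  have [ka|_] := eqVneq (path_node u v p.+2 k) a; last first.
    rewrite /= !mul0r add0r -mulnb natrM; ring.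
  rewrite -ka [path_node _ _ _ k.+1 == path_node _ _ _ k]eq_sym (negPf kk) /=.
  rewrite !mul0r addr0 andbF orbF mul1r; ring.
rewrite big_split /= !sumr_indicator; ring.
Qed.

(** y is scaled by [cheb p.+2] and continued along the path by a solution [z] of the [cheb]
    recurrence with matching values at both ends. The new neighbours of u and v have values z 1 and
    (-1)^s z 1, which accounts for the term subtracted from f. *)
Lemma resolvent_at_glue (V : finType) (e : V -> V -> nat) (u v : V) (s : bool)
    (f c : {poly rat}) p : u != v -> resolvent_at e u v s f c ->
  resolvent_at (glue_path e u v p.+2) (inl u) (inl v) s
    (cheb p.+2 * f - c * (cheb p.+1 + (-1) ^+ s)) (cheb p.+2 * c).
Proof.
move=> uv [y [yE yu yv]].
pose z k := c * (cheb (p.+2 - k) + (-1) ^+ s * cheb k).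
have s2 : (-1) ^+ s * (-1) ^+ s = 1 :> {poly rat} by rewrite -expr2 sqrr_sign.
pose Y (a : V + 'I_p.+1) : {poly rat} :=
  match a with inl x => cheb p.+2 * y x | inr i => z i.+1 end.
exists Y.
have Yz k : (k <= p.+2)%N -> Y (path_node u v p.+2 k) = z k.
  case: k => [_|k]; first by rewrite /= yu /z subn0 mulr0 addr0 mulrC.
  rewrite ltnS leq_eqVlt => /predU1P[->|lt_k] /=.
    rewrite insubF ?ltnn //= yv /z subnn /= add0r; ring.
  by rewrite (insubT (fun j => j < p.+1)%N lt_k).
split; last 1 first.
- by rewrite /= yv; ring.
- move=> a; rewrite glue_path_sum //.
  have -> : \sum_(k < p.+2) Y (path_node u v p.+2 k.+1) * (path_node u v p.+2 k == a)%:R =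
      \sum_(k < p.+2) z k.+1 * (path_node u v p.+2 k == a)%:R.
    by apply: eq_bigr => k _; rewrite Yz.
  have -> : \sum_(k < p.+2) Y (path_node u v p.+2 k) * (path_node u v p.+2 k.+1 == a)%:R =
      \sum_(k < p.+2) z k * (path_node u v p.+2 k.+1 == a)%:R.
    by apply: eq_bigr => k _; rewrite Yz // ltnW.
  case: a => [x|i].
    have -> : \sum_(k < p.+2) z k.+1 * (path_node u v p.+2 k == inl x)%:R =
        z 1%N * (x == u)%:R.
      rewrite -(sumr_indicator (fun k : 'I_p.+2 => z k.+1 * (x == u)%:R) ord0).
      apply: eq_bigr => k _; rewrite path_node_inl // andbC -mulnb natrM.
      by rewrite mulrA -val_eqE.
    have -> : \sum_(k < p.+2) z k * (path_node u v p.+2 k.+1 == inl x)%:R =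
        z p.+1 * (x == v)%:R.
      rewrite -(sumr_indicator (fun k : 'I_p.+2 => z k * (x == v)%:R) ord_max).
      apply: eq_bigr => k _; rewrite path_nodeS_inl // andbC -mulnb natrM.
      by rewrite mulrA -val_eqE.
    have -> : \sum_w (e x w)%:R * Y (inl w) = cheb p.+2 * ('X * y x -
        f * ((x == u)%:R + (-1) ^+ s * (x == v)%:R)).
      rewrite -yE opprB addrC subrK mulr_sumr; apply: eq_bigr => w _; rewrite /Y; ring.
    have z1E : z 1%N = c * (cheb p.+1 + (-1) ^+ s) by rewrite /z subSS subn0 mulr1.
    have zpE : z p.+1 = (-1) ^+ s * z 1%N.
      rewrite z1E /z subSnn; move: (_ ^+ s) s2 => g g2; rewrite [cheb 1]/=; ring: g2.
    rewrite zpE z1E -[Y (inl x)]/(cheb p.+2 * y x); move: (cheb p.+2) (cheb p.+1) => S2 S1.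
    by rewrite !(inj_eq inl_inj); ring.
  have -> : \sum_(k < p.+2) z k.+1 * (path_node u v p.+2 k == inr i)%:R = z i.+2.
    rewrite -(sumr_indicator (fun k : 'I_p.+2 => z k.+1) (lift ord0 i)).
    by apply: eq_bigr => k _; rewrite path_node_inr.
  have -> : \sum_(k < p.+2) z k * (path_node u v p.+2 k.+1 == inr i)%:R = z i.
    rewrite -(sumr_indicator (fun k : 'I_p.+2 => z k) (widen_ord (leqnSn _) i)).
    by apply: eq_bigr => k _; rewrite path_nodeS_inr.
  rewrite -[Y (inr i)]/(z i.+1) -[inr i == inl u]/false -[inr i == inl v]/false.
  rewrite mulr0 addr0 mulr0 add0r.
  have [j [j2 [j1 j0]]] : exists j, (p.+2 - i = j.+2 /\ (p.+2 - i.+1 = j.+1 /\ p.+2 - i.+2 = j))%N.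
    by exists (p - i)%N; have := ltn_ord i; split; [|split]; lia.
  by rewrite /z j0 j1 j2 (chebSS j) (chebSS i); ring.
by rewrite /= yu.
Qed.

(** * Resolvents of cospectral vertices *)

Lemma char_poly_mxsub (A : comNzRingType) m n (h : 'I_m -> 'I_n) (M : 'M[A]_n) :
  m = n -> injective h -> char_poly (mxsub h h M) = char_poly M.
Proof.
move=> mn; case: _ / mn in h M * => h_inj; pose p := perm h_inj.
have -> : mxsub h h M = row_perm p (col_perm p M).
  by apply/matrixP => i j; rewrite !mxE !permE.
rewrite /char_poly.
have -> : char_poly_mx (row_perm p (col_perm p M)) = row_perm p (col_perm p (char_poly_mx M)).
  by apply/matrixP => i j; rewrite !mxE (inj_eq perm_inj).
rewrite row_permE col_permE !det_mulmx !det_perm odd_permV mulrCA -signr_addb.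
by rewrite addbb mulr1.
Qed.

(** The diagonal cofactor numbers the vertices by skipping w; the enumeration of the subtype differs
    from this by a permutation, harmless by [char_poly_mxsub]. *)
Lemma char_poly_del_vertex (V : finType) (e : V -> V -> nat) (w : V) :
  \adj (char_poly_mx (adjmx rat e)) (enum_rank w) (enum_rank w) =
  char_poly (adjmx rat (del_vertices e [set w]%SET)).
Proof.
rewrite mxE /cofactor exprD -expr2 sqrr_sign mul1r row'_col'_char_poly_mx.
set A := adjmx rat e; set i := enum_rank w.
have /fin_all_exists[h hE] (k : 'I_#|{: {x : V | x \notin [set w]%SET}}|) :
    exists j, lift i j = enum_rank (val (enum_val k)).
  have : i != enum_rank (val (enum_val k)).
    rewrite (inj_eq enum_rank_inj) eq_sym.
    by have := valP (enum_val k); rewrite !inE.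
  by case/unlift_some => j -> _; exists j.
have h_inj : injective h.
  move=> k l /(congr1 (lift i)); rewrite !hE => /enum_rank_inj/val_inj.
  exact: enum_val_inj.
have cardW : #|{: {x : V | x \notin [set w]%SET}}| = #|V|.-1.
  by rewrite card_sig -(cardC1 w); apply: eq_card => x; rewrite !inE.
apply: etrans (esym (char_poly_mxsub _ cardW h_inj)) _; congr char_poly.
by apply/matrixP => k l; rewrite !mxE !hE !enum_rankK.
Qed.

(** y combines the columns u and v of the adjugate of X - A. This adjugate is symmetric, and by
    cospectrality its diagonal entries at u and v agree; hence y v = (-1)^s y u. *)
Lemma cospectral_resolvent_at (R : realType) (V : finType) (e : V -> V -> nat)
    (u v : V) (s : bool) : is_graph e -> cospectral R e u v ->
  exists c, resolvent_at e u v s (char_poly (adjmx rat e)) c.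
Proof.
move=> [eC _] cosp; set A := adjmx rat e; set B := char_poly_mx A.
have BT : B^T = B.
  by apply/matrixP => i j; rewrite !mxE (eq_sym j) eC.
have adjC i j : \adj B i j = \adj B j i by rewrite -[in LHS]BT -trmx_adj mxE.
have adjuv : \adj B (enum_rank u) (enum_rank u) = \adj B (enum_rank v) (enum_rank v).
  rewrite !char_poly_del_vertex; apply: (@map_poly_inj _ _ (ratr : {rmorphism rat -> R})).
  have mapE w : map_poly ratr (char_poly (adjmx rat (del_vertices e [set w]%SET))) =
      char_poly (adjmx R (del_vertices e [set w]%SET)).
    rewrite map_char_poly; congr char_poly; apply/matrixP => i j.
    by rewrite !mxE rmorph_nat.
  by rewrite !mapE.
pose y x := \adj B (enum_rank x) (enum_rank u) +
  (-1) ^+ s * \adj B (enum_rank x) (enum_rank v).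
exists (y u), y; split=> //; last by rewrite /y mulrDr signrMK -adjuv (adjC (enum_rank v)) addrC.
have BE x z : B (enum_rank x) (enum_rank z) = 'X * (x == z)%:R - (e x z)%:R.
  by rewrite !mxE !enum_rankK (inj_eq enum_rank_inj) mulr_natr polyC_natr.
have BadjE x w : 'X * \adj B (enum_rank x) (enum_rank w) -
    \sum_z (e x z)%:R * \adj B (enum_rank z) (enum_rank w) =
    char_poly A * (x == w)%:R.
  have /matrixP/(_ (enum_rank x) (enum_rank w)) := mul_mx_adj B.
  rewrite [in RHS]mxE (inj_eq enum_rank_inj) mulr_natr => <-; rewrite [RHS]mxE.
  rewrite (reindex (@enum_rank V)) /=; last exact: onW_bij (enum_rank_bij V).
  rewrite -[X in X - _](sumr_indicator
    (fun z => 'X * \adj B (enum_rank z) (enum_rank w)) x) -sumrB.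
  by apply: eq_bigr => z _; rewrite BE (eq_sym z); ring.
move=> x; transitivity
  (('X * \adj B (enum_rank x) (enum_rank u) -
      \sum_z (e x z)%:R * \adj B (enum_rank z) (enum_rank u)) +
   (-1) ^+ s * ('X * \adj B (enum_rank x) (enum_rank v) -
      \sum_z (e x z)%:R * \adj B (enum_rank z) (enum_rank v))); last by rewrite !BadjE; ring.
have -> : \sum_z (e x z)%:R * y z =
    \sum_z (e x z)%:R * \adj B (enum_rank z) (enum_rank u) +
    (-1) ^+ s * \sum_z (e x z)%:R * \adj B (enum_rank z) (enum_rank v).
  by rewrite mulr_sumr -big_split; apply: eq_bigr => z _; rewrite /y /=; ring.
by rewrite /y; ring.
Qed.

(** The largest size is attained at u or v: elsewhere X y_x is a combination of values of y, which a
    nonzero y_x of maximal size would exceed. So X c dominates the sum over neighbours in f. *)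
Lemma resolvent_at_size (V : finType) (e : V -> V -> nat) (u v : V) (s : bool)
    (f c : {poly rat}) : u != v -> f \is monic -> resolvent_at e u v s f c ->
  c \is monic /\ size f = (size c).+1.
Proof.
move=> uv mf [y [yE yu yv]]; pose D := (\max_x size (y x))%N.
have sum_le x : (size (\sum_z (e x z)%:R * y z)%R <= D)%N.
  apply: leq_trans (size_sum _ _ _) _; apply/bigmax_leqP => z _.
  apply: leq_trans _ (leq_bigmax z); rewrite mulr_natl -scaler_nat.
  exact: size_scale_leq.
have eq_u : 'X * c - \sum_z (e u z)%:R * y z = f.
  by rewrite -yu yE eqxx (negPf uv) mulr0 addr0 mulr1.
have sc : size c = D.
  apply/eqP; rewrite eqn_leq -{1}yu leq_bigmax //=.
  have [|x0 DE] := @bigop.eq_bigmax V (fun x => size (y x)).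
    by apply/card_gt0P; exists u.
  rewrite /D DE; have [->|x0u] := eqVneq x0 u; first by rewrite yu.
  have [->|x0v] := eqVneq x0 v.
    by rewrite yv mulr_sign; case: ifP => _; rewrite ?size_polyN.
  have [->|y0] := eqVneq (y x0) 0; first by rewrite size_poly0.
  have := sum_le x0; have /eqP := yE x0.
  rewrite (negPf x0u) (negPf x0v) mulr0 addr0 mulr0 subr_eq0 => /eqP <-.
  by rewrite mulrC size_mulX // -DE ltnn.
have c0 : c != 0.
  apply: contraTneq mf => c0; rewrite -eq_u c0 mulr0 sub0r.
  have := sum_le u; rewrite -sc c0 size_poly0 leqn0 size_poly_eq0 => /eqP ->.
  by rewrite oppr0 monicE lead_coef0 eq_sym oner_eq0.
have lt_size : (size (- \sum_z (e u z)%:R * y z)%R < size ('X * c)%R)%N.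
  by rewrite size_polyN mulrC size_mulX // sc ltnS.
split; last by rewrite -eq_u size_polyDl // mulrC size_mulX.
by move: mf; rewrite -eq_u monicE lead_coefDl // mulrC lead_coefMX -monicE.
Qed.

(** * Comparing the means before and after gluing *)

Lemma monic_coprime_factors (f c : {poly rat}) : f \is monic -> c \is monic ->
  exists d f' c', [/\ d != 0, f = d * f', c = d * c', coprimep f' c' &
    f' \is monic /\ c' \is monic].
Proof.
move=> mf mc; pose g := gcdp f c.
have g0 : g != 0 by rewrite gcdp_eq0 negb_and monic_neq0.
pose a := lead_coef g; have a0 : a != 0 by rewrite lead_coef_eq0.
pose d := a^-1 *: g.
have md : d \is monic by rewrite monicE lead_coefZ mulVf.
have factor p : g %| p -> p = d * (a *: (p %/ g)).
  move=> gp; rewrite -scalerAl -scalerAr scalerA mulVf // scale1r.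
  by rewrite mulrC divpK.
have fE := factor _ (dvdp_gcdl f c); have cE := factor _ (dvdp_gcdr f c).
exists d, (a *: (f %/ g)), (a *: (c %/ g)); split=> //.
- by rewrite scaler_eq0 negb_or invr_eq0 a0.
- by rewrite coprimepZl // coprimepZr // coprimep_div_gcd // monic_neq0.
by split; rewrite -(monicMl _ md) -?fE -?cE.
Qed.

Lemma monic_sub_lower (A : idomainType) (p r : {poly A}) : p \is monic ->
  (size r < (size p).-1)%N ->
  [/\ size (p - r) = size p, p - r \is monic & subcoef (p - r) = subcoef p].
Proof.
move=> mp rp; have lt_size : (size (- r)%R < size p)%N.
  by rewrite size_polyN (leq_trans rp) // leq_pred.
have sz : size (p - r) = size p by rewrite size_polyDl.
split=> //; first by rewrite monicE lead_coefDl // -monicE.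
rewrite /subcoef sz mulrBr coefB (coefXM r).
by case: ((size p).-1) rp => // n /leq_sizeP -> //; rewrite subr0.
Qed.

(** Cross-multiplied, the equality is linear in Q with rational coefficients, so the coefficient n -
    m of Q vanishes. *)
Lemma transcendental_ratio (R : realType) (Q : R) (a b : rat) (m n : nat) :
  transcendental Q -> (0 < m)%N -> (0 < n)%N ->
  (ratr a - Q) / m%:R = (ratr b - Q) / n%:R -> m = n /\ a = b.
Proof.
move=> trQ m0 n0 /eqP; rewrite eqr_div ?pnatr_eq0 -?lt0n // => /eqP eqQ.
have mn : m = n.
  apply/eqP; apply: contra_notT trQ => mn.
  have nm0 : n%:R - m%:R != 0 :> R by rewrite subr_eq0 eqr_nat eq_sym.
  have -> : Q = ratr ((a * n%:R - b * m%:R) / (n%:R - m%:R)).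
    rewrite fmorph_div rmorphB !rmorphM !rmorph_nat rmorphB !rmorph_nat /=.
    apply: (canRL (mulfK nm0)); move: eqQ; rewrite !mulrBl mulrBr => eqQ; lra.
  exact: algebraic_id.
split=> //; move: eqQ; rewrite mn => /mulIf ab.
have /addIr : ratr a - Q = ratr b - Q by apply: ab; rewrite pnatr_eq0 -lt0n.
exact: fmorph_inj.
Qed.

Theorem theorem4p5 (R : realType) (V : finType) (e : V -> V -> nat) (u v : V)
    (Q : R) :
  is_graph e ->
  u != v ->
  cospectral R e u v ->
  ~~ eigenvalue (adjmx R (del_vertices e [set u; v])) 0 ->
  transcendental Q ->
  induces_PGST e u v Q \/
  exists S : set nat, infinite_set S /\
    forall q : nat, S q ->
      induces_PGST (glue_path e u v q) (inl u) (inl v) Q.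
Proof.
move=> graph_e uv cosp _ trQ; set phi := char_poly (adjmx rat e).
have mphi : phi \is monic by apply: char_poly_monic.
have /choice[C resC] s := cospectral_resolvent_at s graph_e cosp.
have mC s : C s \is monic by have [] := resolvent_at_size uv mphi (resC s).
have sC s : size phi = (size (C s)).+1 by have [] := resolvent_at_size uv mphi (resC s).
have /choice[d /choice[f /choice[c fac]]] s := monic_coprime_factors mphi (mC s).
have d0 s : d s != 0 by have [] := fac s.
have phiE s : phi = d s * f s by have [] := fac s.
have CE s : C s = d s * c s by have [] := fac s.
have fc s : coprimep (f s) (c s) by have [] := fac s.
have mf s : f s \is monic by have [_ _ _ _ []] := fac s.
have mc s : c s \is monic by have [_ _ _ _ []] := fac s.
have c_gt0 s : (0 < size (c s))%N by rewrite size_poly_gt0 monic_neq0.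
have sf s : size (f s) = (size (c s)).+1.
  have := sC s; rewrite (phiE s) CE !size_mul ?d0 ?monic_neq0 //.
  have : (0 < size (d s))%N by rewrite size_poly_gt0.
  have : (0 < size (f s))%N by rewrite size_poly_gt0 monic_neq0.
  move: (c_gt0 s); move: (size (d s)) (size (f s)) (size (c s)) => x y z; lia.
have [eqT|neqT] := eqVneq
    ((ratr (subcoef (f true)) - Q) / (size (c true))%:R)
    ((ratr (subcoef (f false)) - Q) / (size (c false))%:R); last first.
  left; apply: (PGST_resolvents graph_e uv trQ d0 _ fc mf mc sf neqT) => s.
  by rewrite -phiE -CE.
have [eq_size eq_sub] := transcendental_ratio trQ (c_gt0 _) (c_gt0 _) eqT.
right; have cc0 : c true * c false != 0 by rewrite mulf_neq0 ?monic_neq0.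
have [L L0 cop] := coprimep_cheb_progression cc0.
(* Lengths q = 2m + 1 with m = (t+1) L have the form j L + 1, so [cheb q] is prime to both c_s; t +
   1 keeps m positive. *)
exists [set q | exists t, q = (t.+1 * L + t.+1 * L).+1%N]%classic; split.
  apply/infiniteP/pcard_leP/injfunPex => /=.
  exists (fun t => (t.+1 * L + t.+1 * L).+1)%N => [t _|t t' _ _ [] tt']; first by exists t.
  have /eqP : (t.+1 * L = t'.+1 * L)%N by move: tt'; rewrite !addnn => /double_inj.
  by rewrite eqn_pmul2r // => /eqP [].
move=> _ [t ->]; case tL : (t.+1 * L)%N => [|p]; first by move: L0 tL; lia.
have copq s : coprimep (cheb (p.+1 + p.+1).+1) (c s).
  have := cop (t.+1 + t.+1)%N; rewrite mulnDl tL coprimepMr => /andP[].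
  by case: s.
pose k (s : bool) := cheb p.+2 - (-1) ^+ s * cheb p.+1.
pose h (s : bool) := cheb p.+2 + (-1) ^+ s * cheb p.+1.
pose l (s : bool) := cheb p.+1 - (-1) ^+ s * cheb p.
have hk s : cheb (p.+1 + p.+1).+1 = h s * k s by have [] := cheb_odd s p.
have hl (s : bool) : cheb (p.+1 + p.+1) + (-1) ^+ s = h s * l s by have [] := cheb_odd s p.
have kc s : coprimep (k s) (c s).
  by apply: coprimep_dvdr (copq s); rewrite (hk s) dvdp_mull.
have lk s : coprimep (l s) (k s) by apply: coprimep_cheb_signed.
have sk s : size (k s) = p.+2 by have [] := cheb_signed_lead s p.
have mk s : k s \is monic by have [] := cheb_signed_lead s p.
have subk (s : bool) : subcoef (k s) = - (-1) ^+ s by have [] := cheb_signed_lead s p.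
have sl s : (size (l s) <= p.+1)%N.
  have [sp _ _] := cheb_lead p; apply: leq_trans (size_polyD _ _) _.
  rewrite size_polyN geq_max sp leqnn mulr_sign /=.
  have -> (b : bool) (q : {poly rat}) : size (if b then - q else q) = size q.
    by case: b => //; rewrite size_polyN.
  by case: (p) => [|p']; [rewrite size_poly0|have [-> _ _] := cheb_lead p'].
(* The degree is at least two below that of [k s * f s], so subtracting [c s * l s] leaves the sum
   of the roots unchanged. *)
have low s : (size (c s * l s)%R < (size (k s * f s)%R).-1)%N.
  apply: leq_ltn_trans (size_mul_leq _ _) _.
  rewrite size_mul ?monic_neq0 // sk sf; move: (sl s) (c_gt0 s).
  by move: (size (l s)) (size (c s)) => x y; lia.
have mkf s : k s * f s \is monic by rewrite monicMl ?mk ?mf.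
have kfl s := monic_sub_lower (mkf s) (low s).
(* The resolvent of the glued graph, with the common factor [d s * h s] split off. *)
apply: (@PGST_resolvents R _ _ _ _ Q (fun s => d s * h s)
  (fun s => k s * f s - c s * l s) (fun s => k s * c s)) => //.
- exact: glue_path_is_graph.
- move=> s; rewrite mulf_neq0 //; apply/eqP => h0.
  have [_ /monic_neq0/eqP[]] := cheb_lead (p.+1 + p.+1).
  by rewrite (hk s) h0 mul0r.
- move=> s; have : resolvent_at (glue_path e u v (p.+1 + p.+1).+1) (inl u) (inl v) s
      (cheb (p.+1 + p.+1).+1 * phi - C s * (cheb (p.+1 + p.+1) + (-1) ^+ s))
      (cheb (p.+1 + p.+1).+1 * C s) by apply: resolvent_at_glue (p + p.+1) uv (resC s).
  have -> : cheb (p.+1 + p.+1).+1 * phi - C s * (cheb (p.+1 + p.+1) + (-1) ^+ s) =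
      d s * h s * (k s * f s - c s * l s).
    rewrite (hl s) (hk s) (phiE s) CE; move: (d s) (h s) (k s) (f s) (c s) (l s).
    by move=> *; ring.
  have -> : cheb (p.+1 + p.+1).+1 * C s = d s * h s * (k s * c s).
    by rewrite (hk s) CE mulrACA [h s * d s]mulrC.
  exact.
(* Modulo k_s the difference is -c_s l_s, modulo c_s it is k_s f_s; in both cases the factors are
   prime to the modulus. *)
- move=> s; rewrite coprimepMr; apply/andP; split; rewrite coprimep_sym.
    have -> : k s * f s - c s * l s = f s * k s + -1 *: (c s * l s).
      by rewrite scaleN1r; ring.
    rewrite coprimep_addl_mul coprimepZr ?oppr_eq0 ?oner_eq0 //.
    by rewrite coprimepMr kc coprimep_sym lk.
  have -> : k s * f s - c s * l s = - l s * c s + k s * f s by ring.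
  by rewrite coprimep_addl_mul coprimepMr coprimep_sym kc coprimep_sym fc.
- by move=> s; have [] := kfl s.
- by move=> s; rewrite monicMl ?mk ?mc.
- move=> s; have [-> _ _] := kfl s; rewrite !size_mul ?monic_neq0 // sf addnS.
  by rewrite sk.
(* Degrees and [subcoef] being equal before gluing, only the contributions 1 and -1 of the two [k s]
   remain; they differ by 2. *)
have [_ _ ->] := kfl true; have [_ _ ->] := kfl false.
rewrite !subcoefM // !subk !size_mul ?monic_neq0 // !sk eq_size eq_sub.
rewrite -subr_eq0 -mulrBl mulf_neq0 //; last by rewrite invr_eq0 pnatr_eq0.
have signE (b : bool) (x : rat) : ratr (- (-1) ^+ b + x) = - (-1) ^+ b + ratr x :> R.
  by rewrite rmorphD rmorphN rmorph_sign.
rewrite !signE expr0 expr1.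
have -> (x : R) : - -1 + x - Q - (- 1 + x - Q) = 2 by ring.
by rewrite pnatr_eq0.
Qed.
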